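(* Let $I\subseteq S=\Bbbk[x_1,\dots,x_n]$ be a squarefree monomial ideal. Then $I$ is Gotzmann if and only if \[I=m_1(x_{i_{1,1}},\dots,x_{i_{1,r_1}})+m_1m_2(x_{i_{2,1}},\dots,x_{i_{2,r_2}})+\cdots+m_1\cdots m_s(x_{i_{s,1}},\dots,x_{i_{s,r_s}})\] for some squarefree monomials $m_1,\dots,m_s$ and variables $x_{i_{j,k}}$ such that all the $m_j$ and all the $x_{i_{j,k}}$ have pairwise disjoint supports.
   Context: Let $\Bbbk$ be a field and $S=\Bbbk[x_1,\dots,x_n]$, $\mathbf m=(x_1,\dots,x_n)$. A monomial ideal is squarefree if its minimal monomial generators are squarefree. For a homogeneous ideal $I$, $I_d$ is its degree-$d$ component, $|I_d|$ its $\Bbbk$-dimension, and $\mathbf m_1I_d$ the span of $\{x_jf: f\in I_d\}$. An ideal $I$ of $S$ is Gotzmann if for every $d$ and every homogeneous ideal $J\subseteq S$ with $|J_d|=|I_d|$ one has $|\mathbf m_1I_d|\le|\mathbf m_1J_d|$.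
   Formalization: The ideal I is assumed proper (I ≠ S): the unit ideal S is a squarefree monomial ideal and is Gotzmann, but is not of the displayed form, since every generator there has degree at least 1. *)

(* Defs.v *)
From HB Require Import structures.
From mathcomp Require Import all_boot all_order all_algebra.
Set Implicit Arguments. Unset Strict Implicit. Unset Printing Implicit Defensive.
Import GRing.Theory.
Local Open Scope ring_scope.

Definition mono (n d : nat) : finType :=
  {a : {ffun 'I_n -> 'I_d.+1} | (\sum_(i < n) (a i : nat))%N == d}.

(* S_d : the degree-d homogeneous component of S = K[x_0..x_(n-1)], i.e. the
   K-vector space with basis the monomials of degree d (a polynomial is given by
   its coefficient function). *)
Definition Sd (K : fieldType) (n d : nat) := {ffun mono n d -> K^o}.

Definition monom (K : fieldType) (n d : nat) (a : mono n d) : Sd K n d :=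
  [ffun b => (b == a)%:R].

(* Multiplication by the variable x_j : S_d -> S_(d+1). The coefficient of x^b
   in x_j * f is the coefficient of x^a in f where b = a + e_j (0 if none). *)
Definition mulx (K : fieldType) (n d : nat) (j : 'I_n) (f : Sd K n d) : Sd K n d.+1 :=
  [ffun b : mono n d.+1 =>
     \sum_(a : mono n d | [forall i, (val b i : nat) == (val a i + (i == j))%N]) f a].

Definition m1 (K : fieldType) (n d : nat) (V : {vspace Sd K n d}) : {vspace Sd K n d.+1} :=
  (\sum_(j < n) (linfun (mulx (K:=K) j) @: V))%VS.

(* A homogeneous ideal of S, given by its graded components J_d (subspaces of
   S_d) stable under multiplication by every variable. *)
Definition is_hideal (K : fieldType) (n : nat) (J : forall d, {vspace Sd K n d}) :=
  forall d (j : 'I_n) (f : Sd K n d), f \in J d -> mulx j f \in J d.+1.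

Definition gotzmann (K : fieldType) (n : nat) (I : forall d, {vspace Sd K n d}) :=
  forall (d : nat) (J : forall e, {vspace Sd K n e}),
    is_hideal J -> \dim (J d) = \dim (I d) -> (\dim (m1 (I d)) <= \dim (m1 (J d)))%N.

(* Degree-d component of the monomial ideal generated by the squarefree
   monomials x_g = prod_(i in g) x_i, g in G: spanned by the monomials of
   degree d divisible by some x_g. *)
Definition sqf_ideal (K : fieldType) (n : nat) (G : seq {set 'I_n}) (d : nat)
  : {vspace Sd K n d} :=
  <<[seq monom K a | a : mono n d <- enum (mono n d) &
       has (fun g : {set 'I_n} => [forall i in g, 0 < (val a i : nat)]%N) G]>>%VS.

(* Generators of m_1 (x_i : i in X_1) + m_1 m_2 (x_i : i in X_2) + ...
   + m_1...m_s (x_i : i in X_s), where supp m_j = M j. *)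
Definition chain_gens (n s : nat) (M X : 'I_s -> {set 'I_n}) : seq {set 'I_n} :=
  [seq (\bigcup_(k < s | (k <= j)%N) M k) :|: [set x] | j : 'I_s <- enum 'I_s, x <- enum (X j)].

(* Main.v *)
Require Import Defs.
From HB Require Import structures.
From mathcomp Require Import all_boot all_order all_algebra.
From mathcomp Require Import zify.
Set Implicit Arguments. Unset Strict Implicit. Unset Printing Implicit Defensive.

(* Slicing a set of monomials of degree d + 1 by a variable x into the part free of
   x and the quotients by x of the rest reduces Macaulay's lower bound on growth to a
   numerical inequality ([mac_slice]). Lex segments attain the bound, and passing to
   initial monomials extends it to arbitrary subspaces, so an ideal is Gotzmann iff it
   attains the bound in every degree. For a squarefree monomial ideal I attaining it,
   equality must hold throughout the slicing argument, so the deletion (the part of I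
   free of x) and the colon ideal I : x attain it too, for every x. By induction on
   the number of variables, a nonzero proper such I contains a variable y or lies in
   some (y): otherwise every variable lies on an edge of the degree-2 part, which
   has to be a spanning star, and the growth in degree 2 and in degree n - 1 is too
   large. Removing y and iterating gives the chain form; conversely the operations
   J |-> y J and J |-> (y) + J preserve attainment of the bound. *)

(** * Macaulay's numerical function *)

(** The number of monomials of degree [d] in [b] variables; the recursion separates the monomials
    free of one variable from its multiples. *)
Fixpoint nmon (b : nat) : nat -> nat :=
  if b is b'.+1 then
    fix nm d := if d is d'.+1 then nmon b' d + nm d' else 1
  else fun d => d == 0.

Lemma nmon0S d : nmon 0 d.+1 = 0. Proof. by []. Qed.
Lemma nmonn0 b : nmon b 0 = 1. Proof. by case: b. Qed.
Lemma nmonSS b d : nmon b.+1 d.+1 = nmon b d.+1 + nmon b.+1 d.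
Proof. by []. Qed.
Arguments nmon : simpl never.

Lemma nmonn1 b : nmon b 1 = b.
Proof. by elim: b => [|b IH] //; rewrite nmonSS IH nmonn0 addn1. Qed.

(* Growth [|m_1 L|] of the lex segment [L] of size [v] in degree [d] and [b]
   variables. If [v <= nmon b d.-1] then [L] is [x_1] times a lex segment;
   otherwise it is [x_1 S_(d-1)] plus a lex segment in one variable less. *)
Fixpoint mac (b : nat) : nat -> nat -> nat :=
  if b is b'.+1 then
    fix mc d v :=
      if d is d'.+1 then
        if v <= nmon b d' then mc d' v
        else nmon b d + mac b' d (v - nmon b d')
      else if v is 0 then 0 else b
  else fun d v => 0.

Lemma mac0n d v : mac 0 d v = 0. Proof. by []. Qed.
Lemma macSS b d v : mac b.+1 d.+1 v =
  if v <= nmon b.+1 d then mac b.+1 d v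
  else nmon b.+1 d.+1 + mac b d.+1 (v - nmon b.+1 d).
Proof. by []. Qed.
Lemma macn0 b v : v <= 1 -> mac b 0 v = b * v.
Proof. by case: b v => [|b] [|[|v]] //=; rewrite ?muln1 ?muln0. Qed.
Arguments mac : simpl never.

Lemma macv0 b d : mac b d 0 = 0.
Proof.
elim: b d => [|b IHb] d //; elim: d => [|d IHd]; first by rewrite macn0 ?muln0.
by rewrite macSS leq0n.
Qed.

Lemma nmon_gt0 b d : 0 < nmon b.+1 d.
Proof. by elim: d => // d IH; rewrite nmonSS addn_gt0 IH orbT. Qed.

Lemma mac_full b d : mac b d (nmon b d) = nmon b d.+1.
Proof.
elim: b d => [|b IHb] d; first by rewrite mac0n nmon0S.
elim: d => [|d IHd]; first by rewrite nmonn0 macn0 // muln1 nmonn1.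
rewrite macSS nmonSS addnK; case: leqP => [le0|_].
  have nb0 : nmon b d.+1 = 0 by lia.
  rewrite nb0 add0n IHd nmonSS [in RHS]nmonSS nb0 add0n.
  by case: b nb0 {IHb IHd le0} => [|b]; rewrite ?nmonSS; [rewrite !nmon0S|have := nmon_gt0 b d; lia].
by rewrite IHb [in RHS]nmonSS nmonSS addnC.
Qed.

Lemma macSl b d v : v <= nmon b.+1 d -> mac b.+1 d.+1 v = mac b.+1 d v.
Proof. by rewrite macSS => ->. Qed.

(** At [w = 0] the first branch of [macSS] applies, but there both branches agree by [mac_full]. *)
Lemma macSr b d w :
  mac b.+1 d.+1 (nmon b.+1 d + w) = nmon b.+1 d.+1 + mac b d.+1 w.
Proof.
case: w => [|w]; first by rewrite addn0 macSl // mac_full macv0 addn0.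
by rewrite macSS ifN ?addKn //; lia.
Qed.

Lemma nmon_mono b d : 0 < b -> nmon b d <= nmon b d.+1.
Proof. by case: b => // b _; rewrite nmonSS leq_addl. Qed.

Lemma nmon_monob b d : nmon b d <= nmon b.+1 d.
Proof. by case: d => [|d]; rewrite ?nmonn0 // nmonSS leq_addr. Qed.

Lemma mac_le b d v v' : v <= v' -> v' <= nmon b d -> mac b d v <= mac b d v'.
Proof.
elim: b d v v' => [|b IHb] d v v' //; elim: d v v' => [|d IHd] v v' le_v le_n.
  by rewrite nmonn0 in le_n; rewrite !macn0; try lia; rewrite leq_mul2l le_v orbT.
have [le1|lt1] := leqP v' (nmon b.+1 d).
  by rewrite !macSl ?IHd //; lia.
rewrite -(subnKC (ltnW lt1)) macSr; have [le2|lt2] := leqP v (nmon b.+1 d).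
  rewrite macSl //; have := IHd _ _ le2 (leqnn _); rewrite mac_full; lia.
rewrite -(subnKC (ltnW lt2)) macSr leq_add2l IHb //; first lia.
by rewrite nmonSS in le_n; lia.
Qed.

(* Macaulay's [t^{<d>}]: the growth of the quotient by a lex segment of codimension
   [t]. For [d > 0] it does not depend on [b] ([cog_stable]), just as [mac b d v]
   does not depend on [d] ([mac_stable]). *)
Definition cog b d t := nmon b d.+1 - mac b d (nmon b d - t).

Lemma mac_bound b d v : v <= nmon b d -> mac b d v <= nmon b d.+1.
Proof. by move=> h; rewrite -mac_full mac_le. Qed.

Lemma cog_mac b d t : t <= nmon b d -> mac b d (nmon b d - t) + cog b d t = nmon b d.+1.
Proof. by move=> h; rewrite subnKC // mac_bound // leq_subr. Qed.

(** When at most [nmon b d.+1] monomials are missing, a lex segment contains all multiples of [x_1],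
    so its complement lives in one variable less. Together with [cogSr] this is the recursion dual
    to [macSS]. *)
Lemma cogSl b d t : t <= nmon b d.+1 -> cog b.+1 d.+1 t = cog b d.+1 t.
Proof.
move=> h; rewrite /cog [nmon b.+1 d.+1]nmonSS (_ : _ - t = nmon b.+1 d + (nmon b d.+1 - t)); last lia.
by rewrite macSr [nmon b.+1 d.+2]nmonSS; lia.
Qed.

Lemma cogSr b d t : t <= nmon b.+1 d ->
  cog b.+1 d.+1 (nmon b d.+1 + t) = nmon b d.+2 + cog b.+1 d t.
Proof.
move=> h; rewrite /cog [nmon b.+1 d.+1]nmonSS (_ : _ + _ - (_ + _) = nmon b.+1 d - t); last lia.
rewrite macSl ?leq_subr // [nmon b.+1 d.+2]nmonSS.
by have := @mac_bound b.+1 d (nmon b.+1 d - t) (leq_subr _ _); rewrite nmonSS; lia.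
Qed.

Lemma cogv0 b d : cog b d 0 = 0.
Proof. by rewrite /cog subn0 mac_full subnn. Qed.

Lemma cog_full b d : cog b d (nmon b d) = nmon b d.+1.
Proof. by rewrite /cog subnn macv0 subn0. Qed.

Lemma mac_stable b d e v : e <= d -> v <= nmon b e -> mac b d v = mac b e v.
Proof.
case: b => [|b] //; move=> /subnKC <-; elim: (d - e) => [|k IH] h; first by rewrite addn0.
rewrite addnS macSl ?IH //; apply: leq_trans h _.
by elim: {IH} k => [|k IH]; rewrite ?addn0 // addnS nmonSS; lia.
Qed.

Lemma cog_stable b c d t : c <= b -> t <= nmon c d.+1 -> cog b d.+1 t = cog c d.+1 t.
Proof.
move=> /subnKC <-; elim: (b - c) => [|k IH] h; first by rewrite addn0.
rewrite addnS cogSl ?IH //; apply: leq_trans h _.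
by elim: {IH} k => [|k IH]; rewrite ?addn0 // addnS (leq_trans IH) // nmon_monob.
Qed.

Lemma cogn0 b t : t <= 1 -> cog b 0 t = b * t.
Proof.
by case: t => [|[|t]] // _; rewrite /cog nmonn0 nmonn1 macn0 ?subn0 ?subnn; lia.
Qed.

(** The missing monomial is a power of the last variable, and in the next degree only the next power
    is missing. *)
Lemma cog1 b d : cog b.+1 d.+1 1 = 1.
Proof.
rewrite (@cog_stable _ 1) ?nmon_gt0 //.
elim: d => [|d IH]; first by rewrite -[in LHS](add0n 1) -(nmon0S 0) cogSr // cogn0.
by rewrite -[in LHS](add0n 1) -(nmon0S d.+1) cogSr ?IH ?nmon0S ?nmon_gt0.
Qed.

(* The partial sums of [mac b d] are submodular under the exchange moving
   [p, q] to the extreme positions [p + q] and [0], or [nmon b d] and [p + q - nmon b d]. *)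
Definition exchange b d := forall p q, p <= nmon b d -> q <= nmon b d ->
  mac b d (minn (p + q) (nmon b d)) + mac b d (p + q - nmon b d)
    <= mac b d p + mac b d q.

Lemma exchange_sub b d p q : exchange b d -> p + q <= nmon b d ->
  mac b d (p + q) <= mac b d p + mac b d q.
Proof.
move=> H h; have := H p q; rewrite (minn_idPl h) (_ : _ - _ = 0) ?macv0; last lia.
by rewrite addn0; apply; lia.
Qed.

Lemma exchange_over b d p q : exchange b d -> p <= nmon b d -> q <= nmon b d ->
  nmon b d <= p + q ->
  nmon b d.+1 + mac b d (p + q - nmon b d) <= mac b d p + mac b d q.
Proof. by move=> H hp hq h; have := H p q hp hq; rewrite (minn_idPr h) mac_full. Qed.

(** Pass to complements: this is [exchange_over] at [nmon b d - p] and [nmon b d - q]. *)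
Lemma exchange_cog b d p q : exchange b d -> p + q <= nmon b d ->
  cog b d p + cog b d q <= cog b d (p + q).
Proof.
move=> H h; have := @exchange_over b d (nmon b d - p) (nmon b d - q) H.
rewrite (_ : _ + _ - _ = nmon b d - (p + q)); last lia.
move=> /(_ (leq_subr _ _) (leq_subr _ _)) H'.
have := @cog_mac b d p; have := @cog_mac b d q; have := @cog_mac b d (p + q); lia.
Qed.

(** Cut [w] at [nmon b.+1 e]. The excess grows alike on both sides by [mac_stable], the rest is
    handled by induction, and subadditivity of [mac b d] joins the two. *)
Lemma mac_le_mac b d e w : exchange b d -> e < d ->
  w <= nmon b.+1 e -> w <= nmon b d -> mac b d w <= mac b.+1 e w.
Proof.
move=> H; elim: e w => [|e IH] w le_ed le1 le2.
  rewrite nmonn0 in le1; rewrite macn0 //.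
  case: b H le2 => [|b] H le2; first by rewrite mac0n.
  by rewrite (@mac_stable _ _ 0) ?nmonn0 // macn0 // leq_mul2r leqnSn orbT.
have [le3|lt3] := leqP w (nmon b.+1 e); first by rewrite macSl // IH //; lia.
rewrite -(subnKC (ltnW lt3)) macSr; set w' := w - _.
have lew' : w' <= nmon b e.+1 by rewrite nmonSS in le1; lia.
rewrite -(@mac_stable b d) //; last lia.
apply: leq_trans (exchange_sub H _) _; first lia.
rewrite leq_add2r; apply: leq_trans (IH _ _ _ _) _; rewrite ?mac_full //; lia.
Qed.

(** Dual of [mac_le_mac]: the same kind of cut, with superadditivity of [cog] in place of
    subadditivity. *)
Lemma cog_le_cog b c d t : exchange b.+1 d -> c <= b ->
  t <= nmon c d.+1 -> t <= nmon b.+1 d -> cog c d.+1 t <= cog b.+1 d t.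
Proof.
move=> H; case: d H => [|d] H.
  case: t => [|[|t]] le_c //; rewrite ?cogv0 // nmonn1 => c0 _.
  by case: c c0 le_c => // c _ le_c; rewrite cog1 cogn0 // muln1.
elim: c t => [|c IH] t le_cb le1 le2.
  by move: le1; rewrite nmon0S leqn0 => /eqP ->; rewrite cogv0.
have [le3|lt3] := leqP t (nmon c d.+2); first by rewrite cogSl // IH //; lia.
rewrite -(subnKC (ltnW lt3)) cogSr; last by rewrite nmonSS in le1; lia.
set t' := t - _; have let' : t' <= nmon c.+1 d.+1 by rewrite nmonSS in le1; lia.
rewrite -(@cog_stable b.+1 c.+1) //; last lia.
apply: leq_trans (exchange_cog H _); last lia.
rewrite leq_add2r; apply: leq_trans (IH _ _ _ _); rewrite ?cog_full //; lia.
Qed.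

(** Induction on [b], then on [d]. A lex segment fills the [S1] multiples of [x_1] before the [S0]
    monomials free of [x_1]; the cases are the positions of [p], [q] and [p + q] relative to these
    sizes. *)
Lemma exchangeP b d : exchange b d.
Proof.
elim: b d => [|b IHb] d; first by move=> p q; rewrite !mac0n.
elim: d => [|d IHd] p q.
  rewrite nmonn0 => hp hq; rewrite !macn0 ?geq_minr //; last lia.
  by rewrite -!mulnDr leq_mul2l; lia.
move: p q; wlog: / forall p q, p <= q -> q <= nmon b.+1 d.+1 ->
  mac b.+1 d.+1 (minn (p + q) (nmon b.+1 d.+1)) + mac b.+1 d.+1 (p + q - nmon b.+1 d.+1)
    <= mac b.+1 d.+1 p + mac b.+1 d.+1 q.
  apply=> p q le_pq hq.
  set S1 := nmon b.+1 d; set S0 := nmon b d.+1.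
  have eS : nmon b.+1 d.+1 = S0 + S1 by rewrite nmonSS.
  have eS' : nmon b.+1 d.+2 = nmon b d.+2 + (S0 + S1) by rewrite nmonSS eS.
  rewrite eS in hq *.
  have lo v : v <= S1 -> mac b.+1 d.+1 v = mac b.+1 d v by exact: macSl.
  have hi w v : v = S1 + w -> mac b.+1 d.+1 v = S0 + S1 + mac b d.+1 w.
    by move=> ->; rewrite macSr eS.
  have gS1 : mac b.+1 d S1 = S0 + S1 by rewrite mac_full eS.
  have hS0 : mac b d.+1 S0 = nmon b d.+2 by rewrite mac_full.
  have gover x y : x <= S1 -> y <= S1 -> S1 <= x + y ->
     S0 + S1 + mac b.+1 d (x + y - S1) <= mac b.+1 d x + mac b.+1 d y.
    by move=> hx hy hxy; have := exchange_over IHd hx hy hxy; rewrite eS.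
  have gsub x y : x + y <= S1 -> mac b.+1 d (x + y) <= mac b.+1 d x + mac b.+1 d y.
    exact: exchange_sub.
  have hsub x y : x + y <= S0 -> mac b d.+1 (x + y) <= mac b d.+1 x + mac b d.+1 y.
    exact: exchange_sub.
  have hover x y : x <= S0 -> y <= S0 -> S0 <= x + y ->
     nmon b d.+2 + mac b d.+1 (x + y - S0) <= mac b d.+1 x + mac b d.+1 y.
    exact: exchange_over.
  (* [K] and [K'] compare the two slices: [K] at equal size, [K'] with the same number [t] of
     monomials missing from one slice while the other is full. *)
  have K w : w <= S1 -> w <= S0 -> mac b d.+1 w <= mac b.+1 d w.
    exact: mac_le_mac (IHb _) (leqnn _).
  have K' t : t <= S0 -> t <= S1 ->
     nmon b d.+2 + mac b.+1 d (S1 - t) <= S0 + S1 + mac b d.+1 (S0 - t).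
    move=> h0 h1; have := @cog_le_cog b b d t IHd (leqnn _) h0 h1.
    by have := cog_mac h0; have := cog_mac h1; rewrite eS -/S0 -/S1; lia.
  have gtail r t : t <= r -> r <= S1 ->
     S0 + S1 + mac b.+1 d (r - t) <= mac b.+1 d r + mac b.+1 d (S1 - t).
    move=> h1 h2; have := gover r (S1 - t).
    by rewrite (_ : _ + _ - _ = r - t); last lia; apply; lia.
  have [q1|q1] := leqP q S1.
    have [pq1|pq1] := leqP (p + q) S1.
      rewrite (minn_idPl _); last lia.
      rewrite (_ : _ - (_ + _) = 0) ?macv0 ?addn0 ?lo //; try lia.
      exact: gsub.
    have [pq2|pq2] := leqP (p + q) (S0 + S1).
      rewrite (_ : _ - (_ + _) = 0) ?macv0 ?addn0; last lia.
      rewrite (hi (p + q - S1)) ?(lo p) ?(lo q) //; try lia.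
      have := gover p q; have := K (p + q - S1); lia.
    rewrite (hi S0 (S0 + S1)) ?(lo p) ?(lo q) ?(lo (p + q - _)); try lia.
    have := gover p q; have := gtail (p + q - S1) S0; have := K' S0.
    rewrite subnn macv0 hS0 (_ : _ - _ - S0 = p + q - (S0 + S1)); last lia.
    lia.
  set q' := q - S1; have eq' : q = S1 + q' by lia.
  have hq' : q' <= S0 by lia.
  rewrite (hi _ _ eq').
  have [p1|p1] := leqP p S1.
    have [pq2|pq2] := leqP (p + q') S0.
      rewrite (minn_idPl _); last lia.
      rewrite (_ : _ - (_ + _) = 0) ?macv0 ?addn0 ?(hi (p + q') (p + q)) ?(lo p) //; try lia.
      have := hsub p q' pq2; have := K p; lia.
    (* Move [S0 - q'] units from [p] to [q], which makes [q] full; [gtail] and [K'] bound the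
       cost. *)
    have l1 : S0 - q' <= p by lia.
    have := gtail p (S0 - q') l1 p1; have := K' (S0 - q') (leq_subr _ _) (leq_trans l1 p1).
    rewrite (subKn hq') (_ : p - (S0 - q') = p + q - (S0 + S1)); last lia.
    have l2 : p + q - (S0 + S1) <= S1 by lia.
    have l3 : S0 + S1 <= p + q by lia.
    rewrite (minn_idPr l3) (hi S0 _ (addnC _ _)) hS0 (lo _ p1) (lo _ l2).
    by clear; lia.
  set p' := p - S1; have ep' : p = S1 + p' by lia.
  have hp' : p' <= S0 by lia.
  rewrite (hi _ _ ep').
  have [c1|c1] := leqP (S1 + (p' + q')) S0.
    rewrite (minn_idPl _); last lia.
    rewrite (_ : _ - (_ + _) = 0) ?macv0 ?addn0 ?(hi (S1 + (p' + q')) (p + q)) //; try lia.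
    have l1 : p' + q' <= S0 by lia.
    have l2 : S1 <= S0 by lia.
    have := hsub p' q' l1; have := hsub S1 (p' + q') c1; have := K S1 (leqnn _) l2.
    by rewrite gS1; clear; lia.
  have l3 : S0 + S1 <= p + q by lia.
  rewrite (minn_idPr l3) (hi S0 _ (addnC _ _)) hS0.
  have [c2|c2] := leqP (p' + q') S0.
    rewrite lo; last lia.
    have l2 : S0 - (p' + q') <= S1 by lia.
    have := hsub p' q' c2; have := K' (S0 - (p' + q')) (leq_subr _ _) l2.
    rewrite (subKn c2) (_ : S1 - (S0 - (p' + q')) = p + q - (S0 + S1)); last lia.
    by clear; lia.
  rewrite (hi (p' + q' - S0)); last lia.
  by have := hover p' q' hp' hq' (ltnW c2); clear; lia.
move=> H p q hp hq; have [le|/ltnW le] := leqP p q; first exact: H.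
by rewrite [p + q]addnC [X in _ <= X]addnC; exact: H.
Qed.

Lemma mac_subadd b d p q : p + q <= nmon b d ->
  mac b d (p + q) <= mac b d p + mac b d q.
Proof. by apply: exchange_sub; exact: exchangeP. Qed.

(** For a lex segment [L] and the last variable [x], the multiples of [x] in [m_1 L] are exactly
    [x L], and the remaining elements are monomials free of [x]. The proof argues on the recursion
    of [mac] instead. *)
Lemma mac_le_add b d v : v <= nmon b.+1 d -> mac b.+1 d v <= v + nmon b d.+1.
Proof.
elim: b d v => [|b IHb] d v.
  elim: d v => [|d IH] v; first by rewrite nmonn0 => h; rewrite macn0 // mul1n leq_addr.
  by rewrite nmonSS !nmon0S add0n => h; rewrite macSl //; have := IH _ h; rewrite nmon0S.
elim: d v => [|d IHd] v.
  by rewrite nmonn0 nmonn1; case: v => [|[|v]] // _; rewrite macn0 //; lia.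
have [le|lt] := leqP v (nmon b.+2 d).
  move=> _; rewrite macSl //; have := IHd _ le.
  by have := @nmon_mono b.+1 d.+1 isT; lia.
rewrite -(subnKC (ltnW lt)) macSr; set w := _ - _ => h.
have e1 := nmonSS b.+1 d; have e2 := nmonSS b d.+1.
have hw : w <= nmon b.+1 d.+1 by lia.
by have := IHb _ _ hw; lia.
Qed.

(* Numerical core of Macaulay's theorem, an analogue of the Eckhoff-Wegner
   inequality: [a0] and [a1] are the sizes of the slices of a set of monomials
   of degree [d + 1] with respect to a variable [x] (the elements not divisible by
   [x], and the quotients by [x] of the others). *)
Lemma mac_slice b d a0 a1 : a0 <= nmon b d.+1 -> a1 <= nmon b.+1 d ->
  mac b.+1 d.+1 (a0 + a1) <= mac b d.+1 a0 + maxn (a0 + a1) (mac b.+1 d a1).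
Proof.
elim: b d a0 a1 => [|b IHb] d a0 a1.
  rewrite nmon0S leqn0 => /eqP -> h1; rewrite macv0 !add0n macSl //.
  by rewrite leq_max leqnn orbT.
elim: d a0 a1 => [|d IHd] a0 a1.
  rewrite nmonn1 nmonn0 => h0 h1; rewrite macn0 //.
  case: a1 h1 => [|[|//]] _; last first.
    rewrite addn1 -(add1n a0) -{1}(nmonn0 b.+2) macSr nmonn1; lia.
  case: a0 h0 => [|a0] h0; first by rewrite macv0.
  rewrite addn0 muln0 maxn0 -{1}[a0.+1]add1n -{1}(nmonn0 b.+2) macSr nmonn1.
  rewrite -{2}[a0.+1]add1n -{1}(nmonn0 b.+1) macSr nmonn1.
  have := IHb 0 a0 0; rewrite nmonn1 nmonn0 macv0 addn0 maxn0; lia.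
move=> h0 h1.
have E1 : nmon b.+2 d.+1 = nmon b.+1 d.+1 + nmon b.+2 d by rewrite nmonSS.
have E2 : nmon b.+1 d.+2 = nmon b d.+2 + nmon b.+1 d.+1 by rewrite nmonSS.
have E3 : nmon b.+2 d.+2 = nmon b.+1 d.+2 + nmon b.+2 d.+1 by rewrite nmonSS.
have [l0|g0] := leqP a0 (nmon b.+1 d.+1); have [l1|g1] := leqP a1 (nmon b.+2 d).
- have l2 : a0 + a1 <= nmon b.+2 d.+1 by lia.
  by rewrite (macSl l2) (macSl l0) (macSl l1); exact: IHd.
(* Here [a0] and the excess [a] are both sizes in [b.+1] variables and degree [d.+1], so [exchangeP]
   merges them. *)
- rewrite (macSl l0) -(subnKC (ltnW g1)) macSr; set a := a1 - _.
  have ha : a <= nmon b.+1 d.+1 by lia.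
  have [le|lt] := leqP (a0 + a) (nmon b.+1 d.+1).
    rewrite macSl; last lia.
    rewrite addnCA macSr; have := mac_subadd le; lia.
  rewrite (_ : a0 + _ = nmon b.+2 d.+1 + (a0 + a - nmon b.+1 d.+1)); last lia.
  rewrite macSr; set w := _ - _; rewrite (@macSl b d.+1 w); last lia.
  have := exchange_over (@exchangeP b.+1 d.+1) l0 ha; rewrite -/w; lia.
- rewrite -(subnKC (ltnW g0)) macSr; set a := a0 - _.
  have ha : a <= nmon b d.+2 by lia.
  rewrite (macSl l1); have [le|lt] := leqP (a + a1) (nmon b.+2 d).
    rewrite macSl; last lia.
    (* Redistribute so that the first slice has size [nmon b.+1 d.+1]; by [mac_le_add] the maximum
       in the induction hypothesis is then the total size. *)
    have := IHd (nmon b.+1 d.+1) (a + a1) (leqnn _) le; rewrite addnA mac_full.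
    by have := mac_le_add le; lia.
  rewrite (_ : _ + _ + a1 = nmon b.+2 d.+1 + (a + a1 - nmon b.+2 d)); last lia.
  rewrite macSr; set w := _ - _; have ww : w <= a by lia.
  (* With an empty second slice the induction hypothesis reads
     [mac b.+1 d.+2 w <= mac b d.+2 w + w]. *)
  have := IHb d.+1 w 0; rewrite macv0 maxn0 addn0.
  by have := mac_le ww ha; lia.
- rewrite -(subnKC (ltnW g0)) macSr; set a := a0 - _.
  rewrite -(subnKC (ltnW g1)) macSr; set a' := a1 - _.
  rewrite (_ : _ + _ + _ = nmon b.+2 d.+1 + (a + a')); last lia.
  rewrite macSr; have := IHb d.+1 a a'; lia.
Qed.

(** * Explicit growth in degree 1 and a strict estimate in degree 2 *)

Lemma mac1S b v : mac b.+1 1 v.+1 = b.+1 + mac b 1 v.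
Proof. by have := macSr b 0 v; rewrite nmonn0 nmonn1. Qed.

(** Successive variables contribute [b], [b - 1], ... new quadratic monomials. The resulting formula
    is doubled and rearranged to avoid division and subtraction. *)
Lemma mac_deg1 b v : v <= b -> 2 * mac b 1 v + v * v = v * (2 * b + 1).
Proof.
elim: b v => [|b IH] [|v] h //.
by rewrite mac1S; have := IH v h; lia.
Qed.

(** [mac_stable] reduces all growths to degree 1, where [mac_deg1] is explicit. The strictness
    serves to exclude two nontrivial slices in [gotz_structure]. *)
Lemma mac_deg2 b a0 r : 0 < a0 -> a0 < b -> 1 < r -> r <= b ->
  mac b.+1 2 (a0 + r) < mac b 2 a0 + mac b.+1 1 r.
Proof.
move=> h1 h2 h3 h4.
rewrite (@mac_stable b 2 1) ?nmonn1 //; last exact: ltnW.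
have e0 := mac_deg1 (ltnW h2); have e1 := @mac_deg1 b.+1 r (leqW h4).
have [le|lt] := leqP (a0 + r) b.+1.
  by rewrite macSl ?nmonn1 //; have := mac_deg1 le; nia.
have -> : a0 + r = nmon b.+1 1 + (a0 + r - b.+1) by rewrite nmonn1; lia.
rewrite macSr; set w := _ - _; rewrite (@mac_stable b 2 1) ?nmonn1 //; last lia.
have hw : w <= b by lia.
have eN : mac b.+1 1 b.+1 = nmon b.+1 2 by rewrite -mac_full nmonn1.
have ew := mac_deg1 hw; have := @mac_deg1 b.+1 b.+1 (leqnn _); rewrite eN.
(* New parameters replace the truncated differences, so that the comparison becomes one of
   polynomials in natural numbers. *)
have [t et] : exists t, b.+1 = r + t.+1 by exists (b - r); lia.
have ewt : a0 = w + t.+1 by lia.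
have [u eu] : exists u, b = a0 + u.+1 by exists (b - a0.+1); lia.
move: ew e0 e1; move: (mac _ _ _) (mac _ _ _) (mac _ _ _) (nmon _ _) => m1 m2 m3 m4.
have er : r = w + u.+1 + 1 by lia.
by rewrite eu ewt er; clear; lia.
Qed.

(** * Monomials and Macaulay's theorem *)

Section Monomials.
Variable n : nat.
Implicit Types (B g : {set 'I_n}) (d : nat).

Definition expo d (a : mono n d) (i : 'I_n) : nat := val a i.

Lemma expo_inj d (a b : mono n d) : expo a =1 expo b -> a = b.
Proof. by move=> eab; apply/val_inj/ffunP => i; apply/val_inj/eab. Qed.

Lemma sum_expo d (a : mono n d) : \sum_i expo a i = d.
Proof. exact/eqP/(valP a). Qed.

Lemma mkmono_subproof d (f : 'I_n -> nat) : \sum_i f i = d ->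
  \sum_(i < n) ([ffun i => inord (f i) : 'I_d.+1] i : nat) == d.
Proof.
move=> sf; rewrite -[X in _ == X]sf; apply/eqP/eq_bigr => i _.
by rewrite ffunE inordK // ltnS -sf (bigD1 i) //= leq_addr.
Qed.

Definition mkmono d f (sf : \sum_i f i = d) : mono n d :=
  Sub [ffun i => inord (f i) : 'I_d.+1] (mkmono_subproof sf).

Lemma expo_mkmono d f (sf : \sum_i f i = d) : expo (mkmono sf) =1 f.
Proof.
move=> i; rewrite /expo /mkmono SubK ffunE inordK // ltnS.
by rewrite -[X in _ <= X]sf (bigD1 i) //= leq_addr.
Qed.

Lemma sum_eq1 (j : 'I_n) : \sum_i (i == j : nat) = 1.
Proof. by rewrite (bigD1 j) //= eqxx big1 // => i /negPf ->. Qed.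

Lemma mulm_subproof d (j : 'I_n) (a : mono n d) : \sum_i (expo a i + (i == j)) = d.+1.
Proof. by rewrite big_split /= sum_expo sum_eq1 addn1. Qed.

Definition mulm d (j : 'I_n) (a : mono n d) : mono n d.+1 := mkmono (mulm_subproof j a).

Lemma expo_mulm d j (a : mono n d) i : expo (mulm j a) i = expo a i + (i == j).
Proof. exact: expo_mkmono. Qed.

Lemma mulm_inj d j : injective (@mulm d j).
Proof.
move=> a b eab; apply: expo_inj => i.
have := congr1 (fun c => expo c i) eab; rewrite !expo_mulm; lia.
Qed.

Lemma mulmC d i j (a : mono n d) : mulm i (mulm j a) = mulm j (mulm i a).
Proof. by apply: expo_inj => k; rewrite !expo_mulm addnAC. Qed.

Lemma divm d j (a : mono n d.+1) : 0 < expo a j -> exists c, a = mulm j c.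
Proof.
move=> aj; have sf : \sum_i (expo a i - (i == j)) = d.
  have := sum_expo a; rewrite (bigD1 j) //= => sa; rewrite (bigD1 j) //= eqxx.
  rewrite (eq_bigr (expo a)) => [|i /negPf ->]; first lia.
  by rewrite subn0.
exists (mkmono sf); apply: expo_inj => i; rewrite expo_mulm expo_mkmono.
by case: eqP => [->|_]; lia.
Qed.

Lemma mono0_inj (a b : mono n 0) : a = b.
Proof.
have z (c : mono n 0) i : expo c i = 0.
  by have := sum_expo c; rewrite (bigD1 i) //=; lia.
by apply: expo_inj => i; rewrite !z.
Qed.

(* Locked so that [inE] does not unfold membership in a support. *)
Definition supp d (a : mono n d) : {set 'I_n} := locked [set i | 0 < expo a i].

Lemma in_supp d (a : mono n d) i : (i \in supp a) = (0 < expo a i).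
Proof. by rewrite /supp -lock inE. Qed.

Lemma supp_mulm d j (a : mono n d) : supp (mulm j a) = j |: supp a.
Proof. by apply/setP => i; rewrite !(inE, in_supp) expo_mulm; case: (i == j); lia. Qed.

Lemma supp0 (a : mono n 0) : supp a = set0.
Proof.
by apply/setP => i; rewrite in_supp inE; have := sum_expo a; rewrite (bigD1 i) //=; lia.
Qed.

Lemma supp_neq0 d (a : mono n d.+1) : exists j, j \in supp a.
Proof.
case: (pickP [pred j | j \in supp a]) => [j aj|a0]; first by exists j.
have := sum_expo a; rewrite big1 // => i _.
by have := a0 i; rewrite /= in_supp; lia.
Qed.

Lemma supp_divm d j (a : mono n d.+1) : j \in supp a -> exists c, a = mulm j c.
Proof. by rewrite in_supp; exact: divm. Qed.

Definition monos B d : {set mono n d} := [set a | supp a \subset B].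

(* The monomials of [m_1 A], where [m] is the ideal generated by the variables in [B]. *)
Definition up B d (A : {set mono n d}) : {set mono n d.+1} :=
  [set b | [exists j in B, [exists a in A, b == mulm j a]]].

Definition del x d (A : {set mono n d}) : {set mono n d} := [set a in A | x \notin supp a].
Definition col x d (A : {set mono n d.+1}) : {set mono n d} := [set a | mulm x a \in A].

Lemma upP B d (A : {set mono n d}) b :
  reflect (exists j a, [/\ j \in B, a \in A & b = mulm j a]) (b \in up B A).
Proof.
rewrite inE; apply: (iffP exists_inP) => [[j jB /exists_inP[a aA /eqP ->]]|].
  by exists j, a.
by move=> [j [a [jB aA ->]]]; exists j => //; apply/exists_inP; exists a.
Qed.

Lemma up_monos B d (A : {set mono n d}) : A \subset monos B d -> up B A \subset monos B d.+1.
Proof.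
move=> /subsetP sA; apply/subsetP => b /upP[j [a [jB aA ->]]].
by have := sA _ aA; rewrite !inE supp_mulm subUset sub1set jB.
Qed.

Lemma del_monos B x d (A : {set mono n d}) :
  A \subset monos B d -> del x A \subset monos (B :\ x) d.
Proof.
move=> /subsetP sA; apply/subsetP => a; rewrite inE => /andP[/sA].
by rewrite !inE subsetD1 => -> ->.
Qed.

Lemma col_monos B x d (A : {set mono n d.+1}) :
  A \subset monos B d.+1 -> col x A \subset monos B d.
Proof.
move=> /subsetP sA; apply/subsetP => a; rewrite inE => /sA.
by rewrite !inE supp_mulm subUset => /andP[].
Qed.

Lemma slice x d (A : {set mono n d.+1}) : A = del x A :|: mulm x @: col x A.
Proof.
apply/setP => a; rewrite !inE; have [ax|ax] := boolP (x \in supp a); last first.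
  rewrite andbT [X in _ || X](_ : _ = false) ?orbF //.
  by apply/imsetP => -[c _ ea]; rewrite ea supp_mulm setU11 in ax.
have [c ec] := supp_divm ax.
by rewrite andbF ec (mem_imset _ _ (@mulm_inj d x)) inE.
Qed.

Lemma card_slice x d (A : {set mono n d.+1}) : #|A| = #|del x A| + #|col x A|.
Proof.
rewrite {1}[A](slice x) cardsU (card_imset _ (@mulm_inj d x)).
rewrite [_ :&: _](_ : _ = set0) ?cards0 ?subn0 //; apply/setP => a; rewrite !inE.
apply/negP => /andP[/andP[_ ax] /imsetP[c _ ea]].
by rewrite ea supp_mulm setU11 in ax.
Qed.

Lemma del_up B x d (A : {set mono n d}) : del x (up B A) = up (B :\ x) (del x A).
Proof.
apply/setP => b; rewrite inE; apply/andP/upP => [[/upP[j [a [jB aA ->]]]]|].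
  rewrite supp_mulm !inE negb_or => /andP[xj xa].
  by exists j, a; split=> //; rewrite !inE ?jB ?aA ?xa // eq_sym xj.
move=> [j [a [/setD1P[jx jB]]]]; rewrite inE => /andP[aA xa] ->; split.
  by apply/upP; exists j, a.
by rewrite supp_mulm !inE negb_or eq_sym jx xa.
Qed.

(** Suppose [x c = x_j a]. If [j != x], then [x] divides [a] and cancels; if [j = x], then [c = a],
    which lies in [del x A] or is [x] times an element of [col x A]. *)
Lemma col_up B x d (A : {set mono n d.+1}) : x \in B ->
  col x (up B A) = del x A :|: up B (col x A).
Proof.
move=> xB; apply/setP => c; rewrite [in RHS]inE; rewrite [in LHS]inE; apply/idP/idP.
  move=> /upP[j [a [jB aA eca]]]; have [ejx|njx] := eqVneq j x.
    move: eca; rewrite ejx => /mulm_inj ->; have [xa|xa] := boolP (x \in supp a).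
      have [c' ec] := supp_divm xa.
      apply/orP; right; apply/upP; exists x, c'; split=> //.
      by rewrite inE -ec.
    by rewrite inE aA xa.
  have : x \in supp a.
    have := congr1 (fun m => x \in supp m) eca; rewrite !supp_mulm !inE eqxx /=.
    by rewrite [x == j]eq_sym (negPf njx) /= => <-.
  move=> /supp_divm[c' ea]; rewrite ea mulmC in eca; rewrite (mulm_inj eca).
  by apply/orP; right; apply/upP; exists j, c'; rewrite inE -ea.
move=> /orP[|/upP[j [a [jB aA ec]]]].
  by rewrite inE => /andP[cA _]; apply/upP; exists x, c.
by apply/upP; exists j, (mulm x a); rewrite ec mulmC; rewrite inE in aA.
Qed.

Lemma card_up B x d (A : {set mono n d.+1}) : x \in B ->
  #|up B A| = #|up (B :\ x) (del x A)| + #|del x A :|: up B (col x A)|.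
Proof. by move=> xB; rewrite (card_slice x) del_up col_up. Qed.

Lemma del_col_up B x d (A : {set mono n d.+1}) : x \in B ->
  A \subset del x A :|: up B (col x A).
Proof.
move=> xB; rewrite {1}[A](slice x) setUS //; apply/subsetP => _ /imsetP[c cA ->].
by apply/upP; exists x, c.
Qed.

Lemma monosS B x d : x \in B -> del x (monos B d) = monos (B :\ x) d.
Proof. by move=> xB; apply/setP => a; rewrite !inE subsetD1. Qed.

Lemma col_monosE B x d : x \in B -> col x (monos B d.+1) = monos B d.
Proof. by move=> xB; apply/setP => a; rewrite !inE supp_mulm subUset sub1set xB. Qed.

Lemma monos0 B : monos B 0 = [set: mono n 0].
Proof. by apply/setP => a; rewrite !inE supp0 sub0set. Qed.

Lemma card_mono0 : #|[set: mono n 0]| = 1.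
Proof.
have sf : \sum_(i < n) 0 = 0 by rewrite big1.
rewrite -[RHS](cards1 (mkmono sf)); apply: eq_card => a.
by rewrite !inE (mono0_inj a (mkmono sf)) eqxx.
Qed.

Lemma monos_set0 d : monos set0 d.+1 = set0.
Proof.
apply/setP => a; rewrite !inE subset0; apply/negP => /eqP a0.
by have [j] := supp_neq0 a; rewrite a0 inE.
Qed.

Lemma card_monos B d : #|monos B d| = nmon #|B| d.
Proof.
elim: d B => [|d IHd] B; first by rewrite monos0 nmonn0 card_mono0.
elim: {B}#|B| {-2}B (erefl #|B|) => [|b IHb] B eB.
  by rewrite eB nmon0S (cards0_eq eB) monos_set0 cards0.
have [x xB] : exists x, x \in B by apply/set0Pn; rewrite -card_gt0 eB.
have ebx : #|B :\ x| = b by move: eB; rewrite (cardsD1 x) xB add1n => -[].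
by rewrite (card_slice x) monosS // col_monosE // (IHb _ ebx) IHd eB ebx nmonSS.
Qed.

(** The only monomial of degree 0 is 1, so Macaulay's bound is always attained there. *)
Lemma card_up0 B (A : {set mono n 0}) : #|up B A| = mac #|B| 0 #|A|.
Proof.
have le1 : #|A| <= 1 by rewrite -card_mono0 subset_leq_card // subsetT.
rewrite macn0 //; have [->|[a aA]] := set_0Vmem A.
  rewrite cards0 muln0; apply/eqP; rewrite cards_eq0; apply/eqP/setP => b.
  by apply/upP; rewrite inE => -[j [a [_]]]; rewrite inE.
have -> : #|A| = 1 by apply/eqP; rewrite eqn_leq le1 card_gt0; apply/set0Pn; exists a.
have inj : injective (fun j => mulm j a).
  move=> i j /(congr1 (fun c => i \in supp c)); rewrite !supp_mulm !supp0 !inE eqxx.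
  by rewrite !orbF => /esym/eqP.
rewrite muln1 -(card_imset (mem B) inj); apply: eq_card => b; apply/upP/imsetP.
  by move=> [j [a' [jB _ ->]]]; exists j => //; rewrite (mono0_inj a' a).
by move=> [j jB ->]; exists j, a.
Qed.

(** Slice [up B A] by [x]. The part free of [x] is bounded by induction on the variables; the
    quotient part has at least [#|A|] elements and contains [up B (col x A)], whence the maximum in
    [mac_slice]. *)
Theorem macaulay B d (A : {set mono n d}) :
  A \subset monos B d -> mac #|B| d #|A| <= #|up B A|.
Proof.
elim: d B A => [|d IHd] B A; first by rewrite card_up0.
elim: {B}#|B| {-2}B (erefl #|B|) A => [|b IHb] B eB A sA; rewrite eB; first by rewrite mac0n.
have [x xB] : exists x, x \in B by apply/set0Pn; rewrite -card_gt0 eB.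
have ebx : #|B :\ x| = b by move: eB; rewrite (cardsD1 x) xB add1n => -[].
have s0 := del_monos x sA; have s1 := col_monos x sA.
rewrite (card_slice x) (card_up _ xB).
apply: leq_trans (mac_slice _ _) _.
- by rewrite -ebx -card_monos subset_leq_card.
- by rewrite -eB -card_monos subset_leq_card.
have h0 := IHb _ ebx _ s0; have h1 := IHd _ _ s1; rewrite eB in h1; rewrite ebx in h0.
have h2 := subset_leq_card (del_col_up A xB); rewrite (card_slice x) in h2.
have h3 : #|up B (col x A)| <= #|del x A :|: up B (col x A)|.
  by rewrite subset_leq_card // subsetUr.
by rewrite leq_add // geq_max h2 (leq_trans h1).
Qed.

Lemma up_full B d : B != set0 -> up B (monos B d) = monos B d.+1.
Proof.
move=> B0; apply/eqP; rewrite eqEsubset up_monos //=; apply/subsetP => a.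
rewrite inE => sa; have [j ja] := supp_neq0 a; have [c ec] := supp_divm ja.
move: sa; rewrite ec supp_mulm subUset sub1set => /andP[jB sc].
by apply/upP; exists j, c; rewrite inE.
Qed.

(** The witnesses follow [macSS]: either [x] times a segment of degree one less, or all multiples of
    [x] together with a segment free of [x]. *)
Lemma lex_exists B d v : v <= nmon #|B| d ->
  exists A : {set mono n d}, [/\ A \subset monos B d, #|A| = v & #|up B A| = mac #|B| d v].
Proof.
elim: d B v => [|d IHd] B v.
  rewrite nmonn0 => v1.
  have [A [sA eA]] : exists A : {set mono n 0}, A \subset monos B 0 /\ #|A| = v.
    case: v v1 => [|[|//]] _; first by exists set0; rewrite sub0set cards0.
    by exists (monos B 0); rewrite subxx monos0 card_mono0.
  by exists A; rewrite card_up0 eA.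
elim: {B}#|B| {-2}B (erefl #|B|) v => [|b IHb] B eB v; rewrite eB => vn.
  exists set0; rewrite sub0set cards0 mac0n.
  move: vn; rewrite nmon0S leqn0 => /eqP ->; split=> //.
  apply/eqP; rewrite cards_eq0; apply/eqP/setP => a; rewrite [RHS]inE.
  by apply/upP => -[j [c [_]]]; rewrite inE.
have B0 : B != set0 by rewrite -card_gt0 eB.
have [x xB] := set0Pn _ B0.
have ebx : #|B :\ x| = b by move: eB; rewrite (cardsD1 x) xB add1n => -[].
have delx (A : {set mono n d}) : del x (mulm x @: A) = set0.
  apply/setP => a; rewrite !inE; apply/negP => /andP[/imsetP[c _ ->]].
  by rewrite supp_mulm setU11.
have colx (A : {set mono n d}) : col x (mulm x @: A) = A.
  by apply/setP => a; rewrite inE (mem_imset _ _ (@mulm_inj d x)).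
have subx (A : {set mono n d}) : A \subset monos B d -> mulm x @: A \subset monos B d.+1.
  move=> /subsetP sA; apply/subsetP => _ /imsetP[c /sA cA ->].
  by move: cA; rewrite !inE supp_mulm subUset sub1set xB.
have [le|lt] := leqP v (nmon b.+1 d).
  have [|A [sA eA uA]] := IHd B v; first by rewrite eB.
  exists (mulm x @: A); rewrite macSl // -eB -uA -eA; split; first exact: subx.
    by rewrite (card_imset _ (@mulm_inj d x)).
  rewrite (card_up _ xB) delx colx set0U -[RHS]add0n; congr (_ + _).
  apply/eqP; rewrite cards_eq0; apply/eqP/setP => a; rewrite [RHS]inE.
  by apply/upP => -[j [c [_]]]; rewrite inE.
have [|A [sA eA uA]] := IHb _ ebx (v - nmon b.+1 d).
  by rewrite ebx; rewrite nmonSS in vn; lia.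
rewrite ebx in uA.
have A0 : del x (A :|: mulm x @: monos B d) = A.
  have /setP eqx := delx (monos B d); apply/setP => a; have := eqx a.
  rewrite !inE; case aA: (a \in A) => /=; last by move=> ->.
  by have /subsetP/(_ _ aA) := sA; rewrite inE subsetD1 => /andP[_ ->].
have A1 : col x (A :|: mulm x @: monos B d) = monos B d.
  have /setP eqx := colx (monos B d); apply/setP => a; have := eqx a; rewrite !inE => <-.
  case aA: (_ \in A) => //=; have /subsetP/(_ _ aA) := sA.
  by rewrite inE subsetD1 supp_mulm setU11 andbF.
exists (A :|: mulm x @: monos B d); split.
- rewrite subUset subx // andbT (subset_trans sA) //.
  by apply/subsetP => a; rewrite !inE => /subset_trans; apply; exact: subD1set.
- by rewrite (card_slice x) A0 A1 eA card_monos eB subnK // ltnW.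
- rewrite (card_up _ xB) A0 A1 uA up_full // (setUidPr _) ?card_monos.
    by rewrite -[in RHS](subnKC (ltnW lt)) macSr eB addnC.
  apply: subset_trans sA _.
  by apply/subsetP => a; rewrite !inE => /subset_trans; apply; exact: subD1set.
Qed.

End Monomials.

(** * Squarefree ideals of minimal growth *)

Section Squarefree.
Variable n : nat.
Implicit Types (B g h : {set 'I_n}) (d : nat) (U : {set {set 'I_n}}).

Definition upclosed U := forall g h, g \in U -> g \subset h -> h \in U.

(* A squarefree ideal is encoded by the set [U] of the supports of its monomials. *)
Definition idl B U d : {set mono n d} := [set a in monos B d | supp a \in U].

(* Equality in Macaulay's bound; equivalent to [gotzmann] by [gotzmannP]. *)
Definition gotz B U := forall d, #|up B (idl B U d)| = mac #|B| d #|idl B U d|.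

Definition colf x U : {set {set 'I_n}} := [set g | x |: g \in U].

Lemma upclosed_colf x U : upclosed U -> upclosed (colf x U).
Proof. by move=> uU g h; rewrite !inE => gU gh; apply: uU gU _; rewrite setUS. Qed.

Lemma idl_monos B U d : idl B U d \subset monos B d.
Proof. by apply/subsetP => a; rewrite inE => /andP[]. Qed.

Lemma card_idl B U d : #|idl B U d| <= nmon #|B| d.
Proof. by rewrite -card_monos subset_leq_card // idl_monos. Qed.

Lemma idl_ext B U U' d : (forall g, g \subset B -> (g \in U) = (g \in U')) ->
  idl B U d = idl B U' d.
Proof.
move=> eU; apply/setP => a; rewrite !inE.
by case sa: (supp a \subset B) => //=; rewrite eU.
Qed.

Lemma gotz_ext B U U' : (forall g, g \subset B -> (g \in U) = (g \in U')) ->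
  gotz B U -> gotz B U'.
Proof. by move=> eU gU d; rewrite -(idl_ext _ eU). Qed.

Lemma del_idl B U x d : x \in B -> del x (idl B U d) = idl (B :\ x) U d.
Proof. by move=> xB; apply/setP => a; rewrite !inE subsetD1 andbAC. Qed.

Lemma col_idl B U x d : x \in B -> col x (idl B U d.+1) = idl B (colf x U) d.
Proof.
by move=> xB; apply/setP => a; rewrite !inE supp_mulm subUset sub1set xB.
Qed.

Lemma cardD1 B x : x \in B -> #|B| = #|B :\ x|.+1.
Proof. by move=> xB; rewrite (cardsD1 x) xB add1n. Qed.

(* Equality holds throughout the inequalities proving Macaulay's theorem. *)
Lemma gotz_slice B U x d : x \in B -> gotz B U ->
  let A0 := idl (B :\ x) U d.+1 in let A1 := idl B (colf x U) d in
  [/\ #|up (B :\ x) A0| = mac #|B :\ x| d.+1 #|A0|,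
      #|A0 :|: up B A1| = maxn (#|A0| + #|A1|) (mac #|B| d #|A1|) &
      mac #|B| d.+1 (#|A0| + #|A1|) = mac #|B :\ x| d.+1 #|A0| + #|A0 :|: up B A1| ].
Proof.
move=> xB gU A0 A1; have := gU d.+1.
rewrite (card_up _ xB) (card_slice x (idl _ _ _)) del_idl // col_idl // -/A0 -/A1.
have h0 : mac #|B :\ x| d.+1 #|A0| <= #|up (B :\ x) A0| by apply/macaulay/idl_monos.
have h1 : mac #|B| d #|A1| <= #|up B A1| by apply/macaulay/idl_monos.
have h2 : #|A0| + #|A1| <= #|A0 :|: up B A1|.
  rewrite /A0 /A1 -del_idl // -col_idl // -card_slice.
  exact/subset_leq_card/del_col_up.
have h3 : #|up B A1| <= #|A0 :|: up B A1| by rewrite subset_leq_card // subsetUr.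
have le1 : #|A1| <= nmon #|B :\ x|.+1 d by rewrite -(cardD1 xB) card_idl.
have := mac_slice (card_idl (B :\ x) U d.+1) le1; rewrite -/A0 -(cardD1 xB).
move: h0 h1 h2 h3; move: (mac _ _ _) (mac _ _ _) (mac _ _ _) #|up _ _| #|up _ _|; by split; lia.
Qed.

Lemma gotz_del B U x : x \in B -> gotz B U -> gotz (B :\ x) U.
Proof.
move=> xB gU [|d]; first exact: card_up0.
by have [] := gotz_slice d xB gU.
Qed.

(** The maximum in [gotz_slice] decides. If it is the total size, [I] in degree [d.+2] is [A0]
    together with [up B A1], which forces [I : x] and [I] to agree in degree [d.+1]; otherwise
    [up B A1] has the least possible size and contains [A0]. *)
Lemma gotz_col_alt B U x d : upclosed U -> x \in B -> gotz B U ->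
  idl B (colf x U) d.+1 = idl B U d.+1 \/
  idl (B :\ x) U d.+2 \subset up B (idl B (colf x U) d.+1) /\
  #|up B (idl B (colf x U) d.+1)| = mac #|B| d.+1 #|idl B (colf x U) d.+1|.
Proof.
move=> uU xB gU; have [_] := gotz_slice d.+1 xB gU.
set A0 := idl _ _ _; set A1 := idl _ _ _ => eA _.
have h1 : mac #|B| d.+1 #|A1| <= #|up B A1| by apply/macaulay/idl_monos.
have h3 : #|up B A1| <= #|A0 :|: up B A1| by rewrite subset_leq_card // subsetUr.
have [le|lt] := leqP (#|A0| + #|A1|) (mac #|B| d.+1 #|A1|).
  right; rewrite (maxn_idPr le) in eA; split; last lia.
  have /eqP -> : up B A1 == A0 :|: up B A1 by rewrite eqEcard subsetUr; lia.
  exact: subsetUl.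
left; rewrite (maxn_idPl (ltnW lt)) in eA.
have eI : idl B U d.+2 = A0 :|: up B A1.
  apply/eqP; rewrite eqEcard eA (card_slice x (idl B U _)) del_idl // col_idl // leqnn andbT.
  by rewrite /A0 /A1 -del_idl // -col_idl // del_col_up.
apply/setP => a; rewrite !inE; case sa: (supp a \subset B) => //=.
apply/idP/idP => [aU|/uU]; last by apply; rewrite subsetUr.
(* Multiplying [a] by a variable of its support keeps the support, so membership in the squarefree
   ideal can be tested one degree higher. *)
have [j ja] := supp_neq0 a; have : mulm j a \in idl B U d.+2.
  rewrite eI inE; apply/orP; right; apply/upP; exists j, a.
  by rewrite !inE sa (subsetP sa).
by rewrite inE supp_mulm => /andP[_]; rewrite (setUidPr _) // sub1set.
Qed.

Lemma gotz_col B U x : upclosed U -> x \in B -> gotz B U -> gotz B (colf x U).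
Proof.
move=> uU xB gU [|d]; first exact: card_up0.
by have [->|[]] := gotz_col_alt d uU xB gU.
Qed.

Lemma mono0_exists : exists a : mono n 0, True.
Proof.
have sf : \sum_(i < n) 0 = 0 by rewrite big1.
by exists (mkmono sf).
Qed.

Lemma supp1P (a : mono n 1) : exists y, supp a = [set y].
Proof.
have [y /supp_divm[c ->]] := supp_neq0 a; exists y.
by rewrite supp_mulm supp0 setU0.
Qed.

Lemma edge_mono x y : exists a : mono n 2, supp a = [set x; y].
Proof.
by have [a _] := mono0_exists; exists (mulm x (mulm y a)); rewrite !supp_mulm supp0 setU0.
Qed.

Lemma var_mono y : exists a : mono n 1, supp a = [set y].
Proof.
by have [a _] := mono0_exists; exists (mulm y a); rewrite supp_mulm supp0 setU0.
Qed.

(** The exponents are at least 1 on [g] and sum to [#|g|], so all of them equal 1. *)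
Lemma card_supp_eq g : #|[set a : mono n #|g| | supp a == g]| = 1.
Proof.
have sf : \sum_i (i \in g : nat) = #|g| by rewrite -sum1_card [RHS]big_mkcond; apply: eq_bigr => i _; case: (i \in g).
rewrite -[RHS](cards1 (mkmono sf)); apply: eq_card => a; rewrite !inE.
apply/eqP/eqP => [ea|->]; last first.
  by apply/setP => i; rewrite in_supp expo_mkmono lt0b.
apply: expo_inj => i; rewrite expo_mkmono.
have le j : true -> (j \in g : nat) <= expo a j ?= iff ((j \in g : nat) == expo a j).
  move=> _; apply: leqif_eq; have := in_supp a j; rewrite ea => ->.
  by case: (expo a j).
have [_] := leqif_sum le; rewrite sf sum_expo eqxx => /esym/forallP/(_ i) /=.
by move=> /eqP.
Qed.

Lemma nmon1 d : nmon 1 d = 1.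
Proof. by elim: d => // d IH; rewrite nmonSS IH nmon0S. Qed.

Lemma mac_pred b d : 0 < d -> mac b.+1 d (nmon b.+1 d).-1 + 1 = nmon b.+1 d.+1.
Proof.
case: d => // d _.
by have := @cog_mac b.+1 d.+1 1 (nmon_gt0 _ _); rewrite cog1 subn1.
Qed.

Lemma gotz_structure B U : upclosed U -> gotz B U -> set0 \notin U ->
  (exists2 g, g \in U & g \subset B) ->
  exists2 y, y \in B & [set y] \in U \/ forall g, g \in U -> g \subset B -> y \in g.
Proof.
elim: {B}#|B| {-2}B (erefl #|B|) U => [|b IH] B eB U uU gU U0 [g0 g0U g0B].
  by move: g0B; rewrite (cards0_eq eB) subset0 => /eqP e0; rewrite -e0 g0U in U0.
suff contra : ~ ((forall y, y \in B -> [set y] \notin U) /\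
    forall y, y \in B -> exists2 g, g \in U & (g \subset B :\ y)).
  case: (pickP [pred y | (y \in B) && (([set y] \in U) ||
      [forall g, (g \in U) ==> (g \subset B) ==> (y \in g)])]) => [y|no].
    rewrite inE => /andP[yB /orP[yU|/forallP yall]]; exists y => //; first by left.
    by right=> g gU' gB; have := yall g; rewrite gU' gB.
  exfalso; apply: contra; split=> y yB; have := no y; rewrite /= yB /=.
    by move=> /negbT; rewrite negb_or => /andP[].
  move=> /negbT; rewrite negb_or => /andP[_]; rewrite negb_forall => /existsP[g].
  by rewrite !negb_imply => /and3P[gU' gB yg]; exists g; rewrite // subsetD1 gB.
move=> [N1 N2].
have cB x : x \in B -> #|B :\ x| = b by move=> xB; move: eB; rewrite (cardD1 xB) => -[].
have subB x : B :\ x \subset B by exact: subD1set.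
(* Every variable lies on an edge, since no colon ideal is contained in a [(y)]. *)
have edge x : x \in B -> exists2 y, y \in B :\ x & [set x; y] \in U.
  move=> xB; have [g gU' gB] := N2 x xB.
  have [||||y yB [yU|yall]] := IH (B :\ x) (cB x xB) (colf x U).
  - exact: upclosed_colf.
  - by apply: gotz_del => //; apply: gotz_col.
  - by rewrite inE setU0 N1.
  - by exists g => //; rewrite inE; apply: uU gU' _; rewrite subsetUr.
  - by exists y => //; move: yU; rewrite inE.
  (* If the colon ideal without [x] lay in [(y)], a support [h] of [I] avoiding [y] would give a
     contradiction after removing [x] from it. *)
  have [h hU hB] := N2 y (subsetP (subB x) _ yB).
  have hx : h :\ x \in colf x U.
    by rewrite inE; apply: uU hU _; apply/subsetP => z zh; rewrite !inE zh andbT orbN.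
  have hxB : h :\ x \subset B :\ x by rewrite setSD // (subset_trans hB).
  by have := yall _ hx hxB; rewrite inE => /andP[_ /(subsetP hB)]; rewrite !inE eqxx.
(* No variable survives in a deletion, hence each deletion is contained in some [(y)]. *)
have deletion x : x \in B -> exists2 y, y \in B :\ x &
    forall g, g \in U -> g \subset B :\ x -> y \in g.
  move=> xB; have [y yB [yU|yall]] := IH (B :\ x) (cB x xB) U uU (gotz_del xB gU) U0 (N2 x xB).
  - by case/negP: (N1 y (subsetP (subB x) _ yB)).
  - by exists y.
have edgesP x y : x \in B -> y \in B -> [set x; y] \in U ->
    exists2 a : mono n 2, a \in idl B U 2 & supp a = [set x; y].
  move=> xB yB xyU; have [a ea] := edge_mono x y; exists a => //.
  by rewrite !inE ea xyU subUset !sub1set xB yB.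
(* By [mac_deg2], either a single edge contains [x] or no edge avoids [x]; in both
   cases the edges share a vertex. *)
have [c cB' star] : exists2 c, c \in B & forall a, a \in idl B U 2 -> c \in supp a.
  have [x xB] : exists x, x \in B by apply/set0Pn; rewrite -card_gt0 eB.
  have [y yB xyU] := edge x xB; have [y' y'B ally'] := deletion x xB.
  have [a1 ea1] := var_mono y.
  have [yx yB'] : y != x /\ y \in B by move: yB; rewrite !inE => /andP[].
  have a1A1 : a1 \in idl B (colf x U) 1 by rewrite !inE ea1 sub1set yB'.
  have a1A : a1 \notin idl B U 1 by rewrite !inE ea1 sub1set yB' (negPf (N1 y yB')).
  (* The variable [y] lies in [I : x] but not in [I], so the two differ in degree 1 and the second
     alternative holds. *)
  case: (gotz_col_alt 0 uU xB gU) => [eA|[sA uA]]; first by rewrite eA (negPf a1A) in a1A1.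
  have [_ _] := gotz_slice 1 xB gU; rewrite (setUidPr sA) uA (cB x xB) eB.
  set A0 := idl _ _ _ in sA *; set A1 := idl _ _ _ in sA uA a1A1 * => enum_eq.
  have cA1 : #|A1| <= b.
    rewrite -(cB x xB) -[X in _ <= X]nmonn1 -card_monos subset_leq_card //.
    apply/subsetP => a; rewrite !inE => /andP[sB xaU].
    have [z ez] := supp1P a; rewrite subsetD1 sB ez inE; apply/eqP => exz.
    by move: xaU; rewrite ez -exz setUid; apply/negP/N1.
  (* Degree-2 elements avoiding [x] are all multiples of [y'], and the square of [y'] is excluded by
     [N1], which leaves at most [b - 1]. *)
  have cA0 : #|A0| < b.
    rewrite -(cB x xB) (cardD1 y'B) ltnS -[X in _ <= X]nmonn1 -card_monos.
    rewrite -(card_imset _ (@mulm_inj n 1 y')) subset_leq_card //.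
    apply/subsetP => a; rewrite !inE => /andP[sB aU].
    have [c ec] := supp_divm (ally' _ aU sB); rewrite ec in sB aU *.
    apply: imset_f; rewrite inE subsetD1; move: sB aU.
    rewrite supp_mulm subUset => /andP[_ ->] /=.
    have [z ->] := supp1P c; rewrite inE; apply: contraTN => /eqP <-.
    by rewrite setUid N1 // (subsetP (subB x)).
  have pA1 : 0 < #|A1| by rewrite card_gt0; apply/set0Pn; exists a1.
  have [A0_0|A0_gt0] := posnP #|A0|.
    exists x => // a aU; apply/negPn/negP => xa.
    have : a \in A0 by rewrite /A0 -del_idl // inE aU.
    by rewrite (cards0_eq A0_0) inE.
  have A1_1 : #|A1| = 1.
    apply/eqP; rewrite eqn_leq pA1 andbT leqNgt; apply/negP => A1_2.
    by have := mac_deg2 A0_gt0 cA0 A1_2 cA1; rewrite enum_eq ltnn.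
  have eA1 a : a \in A1 -> a = a1.
    by have /eqP/cards1P[a2 e2] := A1_1; move: a1A1; rewrite e2 !inE => /eqP -> /eqP.
  exists y => // a aU; have [xa|xa] := boolP (x \in supp a).
    have [c ec] := supp_divm xa; rewrite ec in aU *.
    have : c \in A1 by rewrite /A1 -col_idl // inE.
    by move/eA1 ->; rewrite supp_mulm ea1 !inE eqxx orbT.
  have /(subsetP sA)/upP[j [c [_ /eA1 -> ->]]] : a \in A0 by rewrite /A0 -del_idl // inE aU.
  by rewrite supp_mulm ea1 !inE eqxx orbT.
have spoke z : z \in B :\ c -> [set c; z] \in U.
  rewrite inE => /andP[]; rewrite inE => zc zB; have [y /setD1P[yz yB] zyU] := edge z zB.
  have [a /star ca ea] := edgesP z y zB yB zyU.
  by move: ca; rewrite ea !inE eq_sym (negPf zc) /= => /eqP ->; rewrite setUC.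
(* Suppose [u] avoids [c] and a further [z]. All supports avoiding [z] share some [y], in particular
   the spokes from [c] to the elements of [u]; hence [u] is at most [[set y]], against [N1]. *)
have rim u : u \in U -> u \subset B :\ c -> u = B :\ c.
  move=> uU' uB; apply/eqP; rewrite eqEsubset uB; apply/subsetP => z zBc.
  have [zc zB] := setD1P zBc; apply/negPn/negP => zu.
  have uBz : u \subset B :\ z by rewrite subsetD1 zu (subset_trans uB).
  have [y /setD1P[yz yB] ally] := deletion z zB.
  have yu := ally u uU' uBz; have /setD1P[yc _] := subsetP uB _ yu.
  case/negP: (N1 y yB); apply: (uU u) => //; apply/subsetP => w wu; rewrite inE.
  have /setD1P[wz _] := subsetP uBz _ wu.
  have /(ally _ (spoke w (subsetP uB _ wu))) : [set c; w] \subset B :\ z.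
    by rewrite subUset !sub1set (subsetP uBz _ wu) !inE eq_sym zc cB'.
  by rewrite !inE (negPf yc) /= eq_sym.
(* Only one generator avoids [c]; it makes the growth in degree [#|B| - 1] too large. *)
have [u uU' uB] := N2 c cB'; have eu := rim u uU' uB.
have b_gt1 : 1 < b.
  rewrite -(cB c cB') -eu ltnNge; apply/negP => le1.
  have [u0|[y yu]] := set_0Vmem u; first by rewrite -u0 uU' in U0.
  case/negP: (N1 y (subsetP (subB c) _ (subsetP uB _ yu))).
  apply: uU uU' _; apply/subsetP => z zu; rewrite inE.
  by have /card_le1_eqP/(_ y z yu zu) /= -> := le1.
have [e eb] : exists e, b = e.+2 by exists b.-2; lia.
have [_ _] := gotz_slice e.+1 cB' gU; rewrite (cB c cB') eB.
set A0 := idl _ _ _; set A1 := idl _ _ _.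
have -> : #|A0| = 1.
  rewrite -[RHS](card_supp_eq (B :\ c)) (cB c cB') eb; apply: eq_card => a; rewrite !inE.
  apply/andP/eqP => [[sa aU]|->]; first exact: rim.
  by rewrite -eu uU'.
(* By the spokes, [I : c] contains every variable other than [c], but no power of [c]: exactly one
   monomial is missing. *)
have eA1 : #|A1| = (nmon b.+1 e.+1).-1.
  rewrite -eB -card_monos -subn1 -(nmon1 e.+1) -(cards1 c) -card_monos.
  have <- : #|monos B e.+1 :&: monos [set c] e.+1| = #|monos [set c] e.+1|.
    apply: eq_card => a; rewrite !inE; case sc: (supp a \subset [set c]); rewrite ?andbF //.
    by rewrite (subset_trans sc) // sub1set.
  rewrite -cardsD; apply: eq_card => a; rewrite !inE; case sB: (supp a \subset B).
    rewrite !andbT /=; apply/idP/idP => [aU|sc].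
      apply/negP => sc; move: aU; rewrite (setUidPl sc); exact/negP/N1.
    have [z za zc] := subsetPn sc; rewrite inE in zc.
    have zB : z \in B :\ c by rewrite !inE zc (subsetP sB).
    by apply: uU (spoke z zB) _; rewrite setUS // sub1set.
  by rewrite andbF.
(* With [N = nmon b.+1 e.+2] the equality makes [N] the sum of [b] and a number that is at least
   [N - 1], against [1 < b]. *)
rewrite eA1 add1n prednK ?nmon_gt0 // macSl // mac_full (@mac_stable _ _ 0) ?nmonn0 // macn0 //.
have := @mac_pred b e.+1 isT.
have : #|up B A1| <= #|A0 :|: up B A1| by rewrite subset_leq_card // subsetUr.
have := @macaulay n B e.+1 A1 (idl_monos _ _ _); rewrite eA1 eB.
by lia.
Qed.

(* The word [w = (y_1, b_1) (y_2, b_2) ...] encodes the ideal obtained from [0] by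
   the operations [J |-> y_i J] (if [b_i]) and [J |-> (y_i) + J], last letter first. *)
Fixpoint wmem (w : seq ('I_n * bool)) g : bool :=
  if w is (y, b) :: w' then
    if b then (y \in g) && wmem w' g else (y \in g) || wmem w' g
  else false.

Lemma wmem_eq w g h : {in unzip1 w, g =i h} -> wmem w g = wmem w h.
Proof.
elim: w => [|[y b] w IH] //= e; rewrite e ?mem_head // IH // => z zw.
by apply: e; rewrite inE zw orbT.
Qed.

(** Each use of [gotz_structure] yields one letter. If [y] lies in [I], continue with the deletion
    of [y]; if [I] lies in [(y)], continue with [I : y] restricted to the other variables. *)
Lemma gotz_word B U : upclosed U -> gotz B U -> set0 \notin U ->
  exists w, [/\ uniq (unzip1 w), {subset unzip1 w <= B} &
                forall g, g \subset B -> (g \in U) = wmem w g].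
Proof.
elim: {B}#|B| {-2}B (erefl #|B|) U => [|b IH] B eB U uU gU U0.
  exists [::]; split=> // g; rewrite (cards0_eq eB) subset0 => /eqP ->.
  exact: negPf.
case: (pickP [pred g | (g \in U) && (g \subset B)]) => [g0 /andP[g0U g0B]|no]; last first.
  by exists [::]; split=> // g gB; have := no g; rewrite /= gB andbT.
have [|y yB Hy] := gotz_structure uU gU U0; first by exists g0.
have eBy : #|B :\ y| = b by move: eB; rewrite (cardD1 yB) => -[].
have ext (w : seq (_ * bool)) : uniq (unzip1 w) -> {subset unzip1 w <= B :\ y} -> forall b,
    uniq (unzip1 ((y, b) :: w)) /\ {subset unzip1 ((y, b) :: w) <= B}.
  move=> uw sw b'; rewrite /= uw andbT; split.
    by apply/negP => /sw; rewrite !inE eqxx.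
  by move=> z; rewrite inE => /predU1P[->//|/sw /setD1P[]].
(* Both alternatives hold when [I = (y)]. Testing [[set y]] first ensures that the colon ideal in
   the other case is proper. *)
have [yU|nyU] := boolP ([set y] \in U).
  have [w [uw sw ew]] := IH _ eBy U uU (gotz_del yB gU) U0.
  have [uw' sw'] := ext w uw sw false; exists ((y, false) :: w); split=> // g gB /=.
  case yg: (y \in g); first by apply: uU yU _; rewrite sub1set.
  by rewrite ew // subsetD1 gB yg.
case: Hy => [yU|ally]; first by rewrite yU in nyU.
have [|||w [uw sw ew]] := IH _ eBy (colf y U).
- exact: upclosed_colf.
- by apply: gotz_del => //; apply: gotz_col.
- by rewrite inE setU0.
have [uw' sw'] := ext w uw sw true; exists ((y, true) :: w); split=> // g gB /=.
case yg: (y \in g) => /=; last by apply/negP => gU'; rewrite ally in yg.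
rewrite (@wmem_eq w g (g :\ y)); last first.
  by move=> z /sw /setD1P[zy _]; rewrite !inE zy.
by rewrite -ew ?setSD // inE setD1K.
Qed.

Lemma up0 B d : up B (set0 : {set mono n d}) = set0.
Proof.
by apply/setP => a; rewrite [RHS]inE; apply/upP => -[j [c [_]]]; rewrite inE.
Qed.

(** Each letter matches a branch of [macSS]: [y J] has an empty slice free of [y], and for [(y) + J]
    the colon by [y] is everything. *)
Lemma word_gotz B w : uniq (unzip1 w) -> {subset unzip1 w <= B} ->
  gotz B [set g : {set 'I_n} | wmem w g].
Proof.
elim: w B => [|[y b] w IH] B /=.
  move=> _ _ d; suff -> : idl B [set g : {set 'I_n} | wmem [::] g] d = set0 by rewrite up0 !cards0 macv0.
  by apply/setP => a; rewrite !inE andbF.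
move=> /andP[yw uw] sw; have yB : y \in B by apply: sw; rewrite mem_head.
have {sw} sw z : z \in unzip1 w -> z \in B by move=> zw; apply: sw; rewrite inE zw orbT.
have wy g : wmem w (y |: g) = wmem w g.
  by apply: wmem_eq => z zw; rewrite !inE; case: eqP yw => // <-; rewrite zw.
case: b => -[|d]; try exact: card_up0.
  rewrite (card_up _ yB) (card_slice y (idl _ _ _)) del_idl // col_idl //.
  have -> : idl (B :\ y) [set g : {set 'I_n} | (y \in g) && wmem w g] d.+1 = set0.
    by apply/setP => a; rewrite !inE subsetD1; case: (y \in supp a); rewrite ?andbF.
  rewrite (@idl_ext _ _ [set g : {set 'I_n} | wmem w g]) => [|g _]; last by rewrite !inE eqxx wy.
  rewrite !up0 !cards0 set0U !add0n IH // (cardD1 yB) macSl // -(cardD1 yB).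
  exact: card_idl.
rewrite (card_up _ yB) (card_slice y (idl _ _ _)) del_idl // col_idl //.
rewrite (@idl_ext (B :\ y) _ [set g : {set 'I_n} | wmem w g]) => [|g]; last first.
  by rewrite subsetD1 => /andP[_ /negPf yg]; rewrite !inE yg.
have -> : idl B (colf y [set g : {set 'I_n} | (y \in g) || wmem w g]) d = monos B d.
  by apply/setP => a; rewrite !inE eqxx andbT.
rewrite up_full; last by apply/set0Pn; exists y.
rewrite (setUidPr _); last first.
  apply: subset_trans (idl_monos _ _ _) _; apply/subsetP => a; rewrite !inE.
  by move/subset_trans; apply; exact: subD1set.
rewrite IH // => [|z zw]; last by rewrite !inE sw // andbT; apply: contraNneq yw => <-.
by rewrite !card_monos (cardD1 yB) addnC [in RHS]addnC macSr.
Qed.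

End Squarefree.

(** * Subspaces and initial monomials *)

Import GRing.Theory.

Section Spans.
Variables (K : fieldType) (n : nat).
Implicit Types (d : nat).
Local Open Scope ring_scope.

Lemma mulx_is_linear d (j : 'I_n) : linear (@mulx K n d j).
Proof.
move=> k f g; apply/ffunP => b; rewrite !ffunE scaler_sumr -big_split /=.
by apply: eq_bigr => a _; rewrite !ffunE.
Qed.

HB.instance Definition _ d (j : 'I_n) :=
  GRing.isLinear.Build K (Sd K n d) (Sd K n d.+1) *:%R (@mulx K n d j) (mulx_is_linear j).

Lemma mulxE d (j : 'I_n) (f : Sd K n d) b :
  mulx j f b = \sum_(a | b == mulm j a) f a.
Proof.
rewrite ffunE; apply: eq_bigl => a; apply/forallP/eqP => [H|-> i].
  by apply: expo_inj => i; rewrite expo_mulm; exact/eqP/H.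
by have := expo_mulm j a i; rewrite /expo => ->.
Qed.

Lemma mulx_mulm d (j : 'I_n) (f : Sd K n d) a : mulx j f (mulm j a) = f a.
Proof. by rewrite mulxE (big_pred1 a) // => c; rewrite (inj_eq (@mulm_inj n d j)) eq_sym. Qed.

Lemma mulx_neq0 d (j : 'I_n) (f : Sd K n d) b : mulx j f b != 0 ->
  exists2 a, b = mulm j a & f a != 0.
Proof.
case: (pickP [pred a | b == mulm j a]) => [a /eqP -> /[!mulx_mulm]|no]; first by exists a.
by rewrite mulxE big_pred0 ?eqxx.
Qed.

Lemma mulx_monom d (j : 'I_n) (a : mono n d) : mulx j (monom K a) = monom K (mulm j a).
Proof.
apply/ffunP => b; rewrite [RHS]ffunE; have [->|nb] := eqVneq b (mulm j a).
  by rewrite mulx_mulm ffunE eqxx.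
apply/eqP/negPn/negP => /mulx_neq0[c eb]; rewrite ffunE.
by case: (c =P a) nb => [ec|]; rewrite ?eqxx // eb ec eqxx.
Qed.

Lemma mem_span_monom d (s : seq (mono n d)) (f : Sd K n d) :
  reflect (forall b, f b != 0 -> b \in s) (f \in <<[seq monom K a | a <- s]>>%VS).
Proof.
apply: (iffP idP).
  elim: s f => [|a s IH] f /=.
    by rewrite span_nil memv0 => /eqP -> b; rewrite ffunE eqxx.
  rewrite span_cons => /memv_addP[_ /vlineP[k ->] [g /IH gs ->]] b.
  by rewrite !ffunE inE; case: (b =P a) => // _; rewrite mulr0n scaler0 add0r => /gs.
move=> fs; have -> : f = \sum_a f a *: monom K a.
  apply/ffunP => b; rewrite sum_ffunE (bigD1 b) //= !ffunE eqxx big1 ?addr0.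
    by rewrite [RHS]mulr1.
  by move=> a ab; rewrite !ffunE eq_sym (negPf ab) mulr0n scaler0.
apply: memv_suml => a _; have [->|/fs fa] := eqVneq (f a) 0; first by rewrite scale0r mem0v.
exact/memvZ/memv_span/map_f.
Qed.

Lemma monom_neq0 d (a b : mono n d) : (monom K a b != 0) = (b == a).
Proof. by rewrite ffunE; case: (b == a); rewrite ?mulr0n ?eqxx ?oner_eq0. Qed.

Lemma free_monom d (s : seq (mono n d)) : uniq s -> free [seq monom K a | a <- s].
Proof.
elim: s => [|a s IH] /=; first by rewrite nil_free.
move=> /andP[as' us]; rewrite free_cons IH // andbT.
by apply: contra as' => /mem_span_monom; apply; rewrite monom_neq0.
Qed.

Definition msp d (A : {set mono n d}) : {vspace Sd K n d} :=
  <<[seq monom K a | a <- enum A]>>%VS.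

Lemma mspP d (A : {set mono n d}) (f : Sd K n d) :
  reflect (forall b, f b != 0 -> b \in A) (f \in msp A).
Proof.
by apply: (iffP (mem_span_monom _ _)) => H b /H; rewrite mem_enum.
Qed.

Lemma monom_msp d (A : {set mono n d}) a : (monom K a \in msp A) = (a \in A).
Proof.
apply/mspP/idP => [|aA b]; first by apply; rewrite monom_neq0.
by rewrite monom_neq0 => /eqP ->.
Qed.

Lemma dim_msp d (A : {set mono n d}) : \dim (msp A) = #|A|.
Proof. by have /eqP -> := free_monom (enum_uniq A); rewrite size_map -cardE. Qed.

Lemma mulx_m1 d (V : {vspace Sd K n d}) j f : f \in V -> mulx j f \in m1 V.
Proof.
move=> fV; have -> : mulx j f = linfun (mulx (K:=K) j) f by rewrite lfunE.
by apply: (subvP (sumv_sup j _ (subvv _))) => //; exact: memv_img.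
Qed.

Lemma m1_msp d (A : {set mono n d}) : m1 (msp A) = msp (up [set: 'I_n] A).
Proof.
apply/eqP; rewrite eqEsubv; apply/andP; split.
  apply/subv_sumP => j _; rewrite limg_span; apply/span_subvP => _ /mapP[_ /mapP[a aA ->] ->].
  rewrite lfunE /= mulx_monom monom_msp; apply/upP; exists j, a.
  by rewrite inE -mem_enum.
apply/span_subvP => _ /mapP[b bA ->]; move: bA; rewrite mem_enum => /upP[j [a [_ aA ->]]].
by rewrite -mulx_monom mulx_m1 // monom_msp.
Qed.

Lemma sqf_ideal_msp (G : seq {set 'I_n}) d :
  sqf_ideal K G d = msp (idl [set: 'I_n] [set h : {set 'I_n} | has (fun g : {set 'I_n} => g \subset h) G] d).
Proof.
apply: eq_span => f; apply/mapP/mapP => -[a aA ->]; exists a => //; move: aA.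
  rewrite mem_filter !mem_enum !inE subsetT andbT => /hasP[g gG /forallP H].
  apply/hasP; exists g => //; apply/subsetP => i ig; rewrite in_supp.
  by have := H i; rewrite ig.
rewrite mem_enum mem_filter mem_enum !inE subsetT andbT => /hasP[g gG /subsetP H].
apply/hasP; exists g => //; apply/forallP => i; apply/implyP => /H.
by rewrite in_supp.
Qed.

(** Exponents read as digits in base [D]. For [D > d] this orders the monomials of degree [d]
    totally, and by [wt_mulm] the order is compatible with multiplication. The base is a parameter
    so that one value serves two consecutive degrees. *)
Definition wt D d (a : mono n d) : nat := (\sum_i expo a i * D ^ i)%N.

Lemma wt_mulm D d j (a : mono n d) : wt D (mulm j a) = (wt D a + D ^ j)%N.
Proof.
rewrite /wt (eq_bigr (fun i => expo a i * D ^ i + (i == j) * D ^ i)%N) => [|i _].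
  rewrite big_split /=; congr (_ + _)%N.
  by rewrite (bigD1 j) //= eqxx mul1n big1 ?addn0 // => i /negPf ->.
by rewrite expo_mulm mulnDl.
Qed.

Lemma digits_inj m D (f g : 'I_m -> nat) :
  (forall i, f i < D)%N -> (forall i, g i < D)%N ->
  (\sum_i f i * D ^ i = \sum_i g i * D ^ i)%N -> f =1 g.
Proof.
elim: m f g => [|m IH] f g fD gD; first by move=> _ [].
have split_sum h : (\sum_(i < m.+1) h i * D ^ i =
    (\sum_(i < m) h (lift ord0 i) * D ^ i) * D + h ord0)%N.
  rewrite big_ord_recl muln1 addnC; congr (_ + _)%N.
  rewrite big_distrl; apply: eq_bigr => i _.
  by rewrite lift0 expnSr mulnA.
rewrite !split_sum => e.
have e0 : f ord0 = g ord0.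
  by have := congr1 (modn^~ D) e; rewrite !modnMDl !modn_small.
have eS : f \o lift ord0 =1 g \o lift ord0.
  apply: IH => [i|i|] /=; [exact: fD | exact: gD |].
  apply/eqP; move: e; rewrite e0 => /eqP; rewrite eqn_add2r eqn_pmul2r //.
  exact: leq_ltn_trans (fD ord0).
by move=> i; case: (unliftP ord0 i) => [k ->|->] //; exact: eS.
Qed.

Lemma expo_le d (a : mono n d) i : (expo a i <= d)%N.
Proof. by rewrite -[X in (_ <= X)%N](sum_expo a) (bigD1 i) //= leq_addr. Qed.

Lemma wt_inj D d : (d < D)%N -> injective (@wt D d).
Proof.
move=> ltD a b eab; apply: expo_inj; apply: digits_inj eab => i;
  exact: leq_ltn_trans (expo_le _ _) ltD.
Qed.

Definition low D d k : {vspace Sd K n d} := msp [set b | wt D b < k]%N.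

(* [a] is the initial monomial of some element of [V], for the order given by [wt D],
   iff the filtration of [V] by [wt D] jumps at [a]. *)
Definition inm D d (V : {vspace Sd K n d}) : {set mono n d} :=
  [set a | ~~ (V :&: low D d (wt D a).+1 <= V :&: low D d (wt D a))%VS].

Lemma lowP D d k (f : Sd K n d) :
  reflect (forall b, f b != 0 -> (wt D b < k)%N) (f \in low D d k).
Proof. by apply: (iffP (mspP _ _)) => H b /H; rewrite inE. Qed.

Lemma inmP D d (V : {vspace Sd K n d}) a : (d < D)%N ->
  reflect (exists f, [/\ f \in V, f a != 0 & forall b, f b != 0 -> (wt D b <= wt D a)%N])
          (a \in inm D V).
Proof.
move=> ltD; rewrite inE; apply: (iffP (@subvPn K (Sd K n d) _ _)) => [[f]|[f [fV fa fle]]].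
  rewrite !memv_cap => /andP[fV /lowP fle]; rewrite fV /= => /lowP flt.
  exists f; split=> //; apply/negP => /eqP fa0; apply: flt => b fb.
  have := fle b fb; rewrite ltnS leq_eqVlt => /orP[/eqP/(wt_inj ltD) eb|//].
  by rewrite eb fa0 eqxx in fb.
exists f; first by rewrite memv_cap fV; apply/lowP.
by rewrite memv_cap fV; apply/lowP => /(_ a fa); rewrite ltnn.
Qed.

(** Raising [k] by one raises the dimension by one exactly when the monomial of weight [k] exists
    and is initial, since two elements with the same initial monomial differ by a multiple up to
    lower terms. *)
Lemma dim_low D d (V : {vspace Sd K n d}) k : (d < D)%N ->
  \dim (V :&: low D d k) = #|[set a in inm D V | wt D a < k]%N|.
Proof.
move=> ltD; elim: k => [|k IH].
  rewrite (_ : [set _ | _] = set0) ?cards0; last by apply/setP => a; rewrite !inE ltn0 andbF.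
  apply/eqP; rewrite dimv_eq0 -subv0; apply/subvP => f; rewrite memv_cap memv0 => /andP[_].
  move=> /lowP f0; apply/eqP/ffunP => b; rewrite ffunE; apply/eqP/negPn/negP.
  by move=> /f0.
have lowS : (V :&: low D d k <= V :&: low D d k.+1)%VS.
  apply/subvP => f; rewrite !memv_cap => /andP[-> /lowP fk].
  by apply/lowP => b /fk /leqW.
case: (pickP [pred a | (a \in inm D V) && (wt D a == k)]) => [a /andP[aV /eqP ea]|no].
  have -> : [set b in inm D V | wt D b < k.+1]%N = a |: [set b in inm D V | wt D b < k]%N.
    apply/setP => b; rewrite in_setU1 [LHS]inE [in RHS]inE.
    rewrite ltnS leq_eqVlt -{1}ea (inj_eq (wt_inj ltD)).
    by case: (b =P a) => //= ->; rewrite aV.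
  rewrite cardsU1 inE ea ltnn andbF -IH add1n.
  have [f [fV fa fle]] := inmP V a ltD aV.
  apply/eqP; rewrite eqn_leq; apply/andP; split.
    have sub : (V :&: low D d k.+1 <= V :&: low D d k + <[f]>)%VS.
      apply/subvP => g; rewrite memv_cap => /andP[gV /lowP gk].
      (* Subtracting this multiple of [f] cancels the coefficient of [g] at [a]. *)
      rewrite -[g](subrK ((g a / f a) *: f)) memv_add ?memvZ ?memv_line //.
      rewrite memv_cap rpredB ?memvZ //=; apply/lowP => b.
      rewrite !ffunE => nz; have [eb|nb] := eqVneq b a.
        by rewrite eb [_ *: _]divfK // subrr eqxx in nz.
      rewrite -ea ltn_neqAle (inj_eq (wt_inj ltD)) nb /=.
      have [gb|/gk] := eqVneq (g b) 0; last by rewrite ltnS ea.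
      have [fb|/fle //] := eqVneq (f b) 0.
      by rewrite gb fb scaler0 subrr eqxx in nz.
    apply: leq_trans (dimvS sub) _; apply: leq_trans (dimv_add_leqif _ _) _.
    by rewrite dim_vline -addn1 leq_add2l leq_b1.
  rewrite ltn_neqAle dimvS // andbT; apply/negP => /eqP ed.
  have /eqP e : (V :&: low D d k == V :&: low D d k.+1)%VS by rewrite eqEdim lowS ed leqnn.
  have : f \in (V :&: low D d k)%VS.
    by rewrite e memv_cap fV; apply/lowP => b /fle; rewrite ea.
  by rewrite memv_cap => /andP[_ /lowP/(_ a fa)]; rewrite ea ltnn.
have -> : [set b in inm D V | wt D b < k.+1]%N = [set b in inm D V | wt D b < k]%N.
  apply/setP => b; rewrite [LHS]inE [RHS]inE ltnS leq_eqVlt.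
  by have := no b => /=; case: (b \in inm D V) => //= ->.
rewrite -IH; apply/eqP; rewrite eqn_leq (dimvS lowS) andbT; apply: dimvS.
apply/subvP => f; rewrite !memv_cap => /andP[fV /lowP fk]; rewrite fV; apply/lowP => b fb.
have := fk b fb; rewrite ltnS leq_eqVlt => /orP[/eqP eb|//].
have /negP[] := no b; rewrite /= eb eqxx andbT; apply/(inmP _ _ ltD).
by exists f; split=> // c /fk; rewrite eb.
Qed.

Lemma dim_inm D d (V : {vspace Sd K n d}) : (d < D)%N -> \dim V = #|inm D V|.
Proof.
move=> ltD; pose k := (\max_(a : mono n d) wt D a).+1.
have ltk (a : mono n d) : (wt D a < k)%N by rewrite ltnS; exact: leq_bigmax.
have := dim_low V k ltD; rewrite (capv_idPl _) => [->|].
  by apply: eq_card => a; rewrite [LHS]inE ltk andbT.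
by apply/subvP => f _; apply/lowP.
Qed.

(** If [f] in [V] has initial monomial [a], then [x_j f] has initial monomial [x_j a]. Hence [inm]
    of [m1 V] contains [up] of [inm] of [V], and [macaulay] applies. The base [d.+2] is large enough
    for degrees [d] and [d.+1]. *)
Theorem macaulay_dim d (V : {vspace Sd K n d}) : (mac n d (\dim V) <= \dim (m1 V))%N.
Proof.
have ltD : (d < d.+2)%N by [].
rewrite (dim_inm V ltD) (dim_inm (m1 V) (ltnSn d.+1)) -{1}[n]card_ord -cardsT.
apply: leq_trans (macaulay _) _; first by apply/subsetP => a _; rewrite inE subsetT.
apply/subset_leq_card/subsetP => _ /upP[j [a [_ /(inmP _ _ ltD)[f [fV fa fle]] ->]]].
apply/inmP => //; exists (mulx j f); rewrite mulx_m1 // mulx_mulm; split=> // b.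
by move=> /mulx_neq0[c -> /fle]; rewrite !wt_mulm leq_add2r.
Qed.

Lemma gotzmannP (I : forall d, {vspace Sd K n d}) U :
  (forall d, I d = msp (idl [set: 'I_n] U d)) -> gotzmann I <-> gotz [set: 'I_n] U.
Proof.
move=> eI; have cn : #|[set: 'I_n]| = n by rewrite cardsT card_ord.
split=> [gI d|gU d J _ eJ]; last first.
  by rewrite eI m1_msp dim_msp gU cn -(dim_msp (idl _ U d)) -eI -eJ macaulay_dim.
apply/eqP; rewrite eqn_leq macaulay ?idl_monos // andbT.
have [A [sA cA uA]] := lex_exists (card_idl [set: 'I_n] U d).
(* The competitor is the ideal generated by the lex segment [A]. Divisibility between monomials of
   equal degree is equality, so its degree-[d] component is spanned by [A]. *)
pose J e := msp [set b : mono n e | [exists a in A, [forall i, expo a i <= expo b i]]%N].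
have hJ : is_hideal J.
  move=> e j f /mspP fJ; apply/mspP => _ /mulx_neq0[b -> /fJ].
  rewrite !inE => /exists_inP[a aA /forallP le]; apply/exists_inP; exists a => //.
  by apply/forallP => i; rewrite expo_mulm (leq_trans (le i)) // leq_addr.
have eJ : J d = msp A.
  congr msp; apply/setP => b; rewrite inE; apply/exists_inP/idP => [[a aA /forallP le]|bA].
    suff -> : b = a by [].
    apply: expo_inj => i; have lei j : true ->
      (expo a j <= expo b j ?= iff (expo a j == expo b j))%N by move=> _; apply: leqif_eq.
    by have [_] := leqif_sum lei; rewrite !sum_expo eqxx => /esym/forallP/(_ i)/eqP.
  by exists b => //; apply/forallP.
by have := gI d J hJ; rewrite eJ eI !m1_msp !dim_msp uA; apply.
Qed.

End Spans.

(** * Chains *)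

Section Chains.
Variable n : nat.
Implicit Types (g h : {set 'I_n}).

Lemma wmem_mul (s : seq 'I_n) w g :
  wmem ([seq (y, true) | y <- s] ++ w) g = all (mem g) s && wmem w g.
Proof. by elim: s => //= y s ->; rewrite andbA. Qed.

Lemma wmem_add (s : seq 'I_n) w g :
  wmem ([seq (y, false) | y <- s] ++ w) g = has (mem g) s || wmem w g.
Proof. by elim: s => //= y s ->; rewrite orbA. Qed.

(** The chain in nested form: multiply by [m_1] the sum of [(X_1)] and [m_2] times the sum of
    [(X_2)] and so on. *)
Definition chain_word s (M X : 'I_s -> {set 'I_n}) : seq ('I_n * bool) :=
  flatten [seq [seq (y, true) | y <- enum (M j)] ++ [seq (x, false) | x <- enum (X j)]
          | j <- enum 'I_s].

Lemma chain_gensP s (M X : 'I_s -> {set 'I_n}) g :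
  reflect (exists j : 'I_s, (forall k : 'I_s, k <= j -> M k \subset g) /\
                            exists2 x, x \in X j & x \in g)
          (has (fun h => h \subset g) (chain_gens M X)).
Proof.
apply: (iffP hasP) => [[_ /allpairsPdep[j [x [_ xX ->]]]]|[j [MG [x xX xg]]]].
  rewrite mem_enum in xX; rewrite subUset sub1set => /andP[/bigcupsP MG xg].
  by exists j; split=> //; exists x.
exists ((\bigcup_(k < s | k <= j) M k) :|: [set x]).
  by apply/allpairsPdep; exists j, x; rewrite !mem_enum.
by rewrite subUset sub1set xg andbT; apply/bigcupsP.
Qed.

Lemma wmem_chain s (M X : 'I_s -> {set 'I_n}) g :
  wmem (chain_word M X) g = has (fun h => h \subset g) (chain_gens M X).
Proof.
(* Generalized to an increasing list of indices, so that the first block can be peeled off; only the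
   [M k] with [k] in the list are constrained. *)
suff H (r : seq 'I_s) : pairwise (fun j k : 'I_s => j < k) r ->
    (wmem (flatten [seq [seq (y, true) | y <- enum (M j)] ++ [seq (x, false) | x <- enum (X j)]
          | j <- r]) g <->
     exists2 j, j \in r & (forall k : 'I_s, k \in r -> k <= j -> M k \subset g) /\
                            exists2 x, x \in X j & x \in g).
  have pw : pairwise (fun j k : 'I_s => j < k) (enum 'I_s).
    rewrite -(pairwise_map val (fun j k => j < k)) val_enum_ord -sorted_pairwise.
      exact: iota_ltn_sorted.
    exact: ltn_trans.
  apply/idP/chain_gensP => [/(H _ pw)[j _ [MG Xg]]|[j [MG Xg]]].
    by exists j; split=> // k; apply: MG; rewrite mem_enum.
  by apply/(H _ pw); exists j; rewrite ?mem_enum //; split=> // k _; exact: MG.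
elim: r => [|j r IH] /=; first by split=> // -[].
move=> /andP[/allP jr /IH {}IH]; rewrite -catA wmem_mul wmem_add.
have Mg : all (mem g) (enum (M j)) = (M j \subset g).
  by apply/allP/subsetP => H y; have := H y; rewrite mem_enum.
have Xg : has (mem g) (enum (X j)) <-> exists2 x, x \in X j & x \in g.
  split=> [/hasP[x]|[x xX xg]]; first by rewrite mem_enum; exists x.
  by apply/hasP; exists x; rewrite ?mem_enum.
rewrite Mg; split=> [/andP[Mj /orP[/Xg Xj|/IH[k kr [MG Xk]]]]|[k]].
- exists j; rewrite ?mem_head //; split=> // k; rewrite inE => /predU1P[->//|/jr].
  by rewrite ltnNge => /negPf ->.
- exists k; rewrite ?inE ?kr ?orbT //; split=> // i; rewrite inE => /predU1P[->//|].
  exact: MG.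
rewrite inE => /predU1P[->|kr] [MG Xk].
  by rewrite MG ?mem_head //=; apply/orP; left; apply/Xg.
rewrite MG ?mem_head ?(ltnW (jr _ kr)) //=; apply/orP; right; apply/IH.
by exists k => //; split=> // i ir; apply: MG; rewrite inE ir orbT.
Qed.

Lemma uniq_chain_word s (M X : 'I_s -> {set 'I_n}) :
  (forall j k : 'I_s, j != k -> [disjoint M j & M k]) ->
  (forall j k : 'I_s, j != k -> [disjoint X j & X k]) ->
  (forall j k : 'I_s, [disjoint M j & X k]) -> uniq (unzip1 (chain_word M X)).
Proof.
move=> dM dX dMX.
have -> : unzip1 (chain_word M X) =
    flatten [seq enum (M j) ++ enum (X j) | j <- enum 'I_s].
  rewrite /unzip1 map_flatten -map_comp; congr flatten; apply: eq_map => j /=.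
  by rewrite map_cat -!map_comp !map_id.
elim: (enum 'I_s) (enum_uniq 'I_s) => //= j r IH /andP[jr /IH ur].
rewrite !cat_uniq !enum_uniq ur /= !andbT; apply/andP; split.
  apply/hasPn => x; rewrite !mem_enum; apply: contraL => xM.
  by rewrite (disjointFr (dMX j j)).
apply/hasPn => x /flattenP[_ /mapP[k kr ->]]; rewrite !mem_cat !mem_enum.
have jk : j != k by apply: contraNneq jr => ->.
rewrite negb_or => /orP[xk|xk].
  by rewrite (disjointFl (dM j k jk)) // (disjointFr (dMX k j)).
by rewrite (disjointFl (dMX j k)) // (disjointFl (dX j k jk)).
Qed.

(** Each letter becomes its own block, with one of [M j], [X j] a singleton and the other empty. An
    empty [M j] stands for the monomial 1, and an empty [X j] contributes no generators. *)
Lemma word_chain (w : seq ('I_n * bool)) : uniq (unzip1 w) ->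
  exists s (M X : 'I_s -> {set 'I_n}),
  [/\ (forall j k : 'I_s, j != k -> [disjoint M j & M k]),
      (forall j k : 'I_s, j != k -> [disjoint X j & X k]),
      (forall j k : 'I_s, [disjoint M j & X k]) &
      forall g, wmem w g = has (fun h => h \subset g) (chain_gens M X)].
Proof.
move=> uw; pose t := in_tuple w.
pose M (j : 'I_(size w)) := [set y | (tnth t j).2 & y == (tnth t j).1].
pose X (j : 'I_(size w)) := [set y | ~~ (tnth t j).2 & y == (tnth t j).1].
have inj j k : (tnth t j).1 = (tnth t k).1 -> j = k.
  have e1 (x0 : 'I_n * bool) (i : 'I_(size w)) : (tnth t i).1 = nth x0.1 (unzip1 w) i.
    by rewrite (tnth_nth x0) (nth_map x0).
  rewrite (e1 (tnth t j) j) (e1 (tnth t j) k) => /eqP.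
  by rewrite nth_uniq ?size_map // => /eqP/val_inj.
have dis (P Q : pred bool) (j k : 'I_(size w)) :
    (j = k -> ~~ (P (tnth t j).2 && Q (tnth t k).2)) ->
    [disjoint [set y | P (tnth t j).2 & y == (tnth t j).1] &
              [set y | Q (tnth t k).2 & y == (tnth t k).1]].
  move=> PQ; rewrite -setI_eq0; apply/eqP/setP => y; rewrite !inE; apply/negP.
  move=> /andP[/andP[Pj /eqP yj] /andP[Qk /eqP yk]].
  by have /inj/PQ := etrans (esym yj) yk; rewrite Pj Qk.
exists (size w), M, X; split=> [j k jk|j k jk|j k|g].
- by apply: (dis id id) => /eqP; rewrite (negPf jk).
- by apply: (dis negb negb) => /eqP; rewrite (negPf jk).
- by apply: (dis id negb) => ->; rewrite andbN.
rewrite -wmem_chain /chain_word.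
have block y b : [seq (z, true) | z <- enum [set z : 'I_n | b & z == y]] ++
    [seq (z, false) | z <- enum [set z : 'I_n | ~~ b & z == y]] = [:: (y, b)].
  have eS : enum [set z : 'I_n | z == y] = [:: y].
    by rewrite -[RHS]enum_set1; apply: eq_enum => z; rewrite !inE.
  have e0 : enum [set z : 'I_n | false] = [::].
    by rewrite -[RHS]enum_set0; apply: eq_enum => z; rewrite !inE.
  by case: b; rewrite /= eS e0.
rewrite (eq_map (g := fun j => [:: tnth t j])) => [|j]; last first.
  by rewrite /M /X block -surjective_pairing.
by rewrite flatten_map1 map_tnth_enum.
Qed.

End Chains.

(** [Hproper] excludes the unit ideal, which attains the bound but does not have the chain form,
    since all chain generators are nonempty. Words mediate between [gotz] and chains in both
    directions. *)
Theorem theorem3p9 (K : fieldType) (n : nat) (G : seq {set 'I_n})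
  (Hproper : set0 \notin G) :
  gotzmann (sqf_ideal K G) <->
  exists (s : nat) (M X : 'I_s -> {set 'I_n}),
    [/\ (forall j k : 'I_s, j != k -> [disjoint M j & M k]),
        (forall j k : 'I_s, j != k -> [disjoint X j & X k]),
        (forall j k : 'I_s, [disjoint M j & X k]) &
        (forall d, sqf_ideal K G d = sqf_ideal K (chain_gens M X) d)].
Proof.
pose up_of (H : seq {set 'I_n}) := [set h : {set 'I_n} | has (fun g : {set 'I_n} => g \subset h) H].
split=> [/(gotzmannP (sqf_ideal_msp K G)) gG|[s [M [X [dM dX dMX eI]]]]].
  have uG : upclosed (up_of G).
    move=> g h; rewrite !inE => /hasP[k kG kg] gh; apply/hasP; exists k => //.
    exact: subset_trans gh.
  have G0 : set0 \notin up_of G.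
    rewrite inE; apply/negP => /hasP[g gG']; rewrite subset0 => /eqP g0.
    by rewrite -g0 gG' in Hproper.
  have [w [uw _ ew]] := gotz_word uG gG G0.
  have [s [M [X [dM dX dMX eM]]]] := word_chain uw.
  exists s, M, X; split=> // d; rewrite !sqf_ideal_msp; congr msp.
  by apply: idl_ext => g gT; rewrite ew // eM inE.
have [_] := gotzmannP (U := up_of (chain_gens M X))
  (fun d => etrans (eI d) (sqf_ideal_msp K (chain_gens M X) d)).
apply; apply: gotz_ext (word_gotz (uniq_chain_word dM dX dMX) _) => [g _|x _].
  by rewrite !inE wmem_chain.
by rewrite inE.
Qed.
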